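(* Let $k\ge1$ be an integer, let $(X,\|\cdot\|_X)$ and $(Y,\|\cdot\|_Y)$ be separable and reflexive Banach spaces, let $\mathcal{X}$ be the Borel $\sigma$-algebra of $X$, let $P$ be a probability measure on $(X,\mathcal{X})$, and let $\{\xi_i\}_{i\in\mathbb{N}}$ be independent $X$-valued random elements with common law $P$ on a probability space $(\Omega,\mathcal{F},\mathbb{P})$. Let $d:X\times Y\to[0,\infty)$ and $r:Y^k\to[0,\infty)$ and assume that: (1) for all $y\in Y$, $\sup_{x\in\mathrm{supp}(P)}d(x,y)<\infty$; (2) for each $x\in X$ and $y\in Y$, if $x_m\to x$ (in norm) and $y_n\rightharpoonup y$ (weakly) as $n,m\to\infty$, then $\liminf_{n,m\to\infty}d(x_m,y_n)\ge d(x,y)$ and $\lim_{m\to\infty}d(x_m,y)=d(x,y)$; (3) for every $y\in Y$ the function $d(\cdot,y)$ is $\mathcal{X}$-measurable; (4) $r$ is weakly lower semi-continuous; (5) $r$ is coercive. Let $\lambda>0$ and, for $\mu=(\mu_1,\dots,\mu_k)\in Y^k$, define $$f_n^{(\omega)}(\mu)=\frac1n\sum_{i=1}^n\min_{1\le j\le k}d(\xi_i^{(\omega)},\mu_j)+\lambda r(\mu),\qquad f_\infty(\mu)=\int_X\min_{1\le j\le k}d(x,\mu_j)\,P(\mathrm{d}x)+\lambda r(\mu).$$ Then for $\mathbb{P}$-almost every $\omega$, $$\min_{\mu\in Y^k}f_\infty(\mu)=\lim_{n\to\infty}\min_{\mu\in Y^k}f_n^{(\omega)}(\mu).$$ Furthermore,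 any sequence of minimizers $\mu^n$ of $f_n^{(\omega)}$ is almost surely weakly precompact and any weak limit point minimizes $f_\infty$.
   Context: $\xi_i^{(\omega)}$ denotes the value of $\xi_i$ at $\omega\in\Omega$. $\mathrm{supp}(P)\subseteq X$ is the smallest closed set whose complement is $P$-null. The product $Y^k$ carries the norm $\|\mu\|_k=\max_j\|\mu_j\|_Y$; weak convergence in $Y^k$ is with respect to this Banach space structure (equivalently, componentwise weak convergence). $r$ is weakly lower semi-continuous if $\liminf_n r(\mu^n)\ge r(\mu)$ whenever $\mu^n\rightharpoonup\mu$ in $Y^k$; $r$ is coercive if $r(\mu)\to\infty$ as $\|\mu\|_k\to\infty$. A sequence is weakly precompact if every subsequence has a weakly convergent further subsequence; a weak limit point of a sequence is the weak limit of some subsequence. *)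

(* Defs.v *)
From HB Require Import structures.
From mathcomp Require Import all_boot all_order all_algebra.
From mathcomp Require Import all_classical all_reals all_analysis.

Set Implicit Arguments.
Unset Strict Implicit.
Unset Printing Implicit Defensive.

Import Order.TTheory GRing.Theory Num.Theory.
Import numFieldNormedType.Exports.

Local Open Scope classical_set_scope.
Local Open Scope ring_scope.

Definition separable (T : topologicalType) :=
  exists2 D : set T, countable D & dense D.

Section dual_space.
Context {R : realType} (V : normedModType R).

Definition continuous_functional : {pred V -> R^o} :=
  fun f => `[< linear f /\ continuous f >].

Lemma continuous_functional_submod : submod_closed continuous_functional.
Proof.
split=> [|a f g /asboolP[lf cf] /asboolP[lg cg]]; apply/asboolP.
  split=> [b x y|x]; last exact: cst_continuous.
  by rewrite /= scaler0 addr0.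
split=> [b x y|x]; last first.
  by apply: (@continuousD R R^o); [apply: continuousZl_tmp; exact: cf|exact: cg].
rewrite !fctE/= lf lg !scalerDr -!addrA; congr (_ + _).
  by rewrite !scalerA mulrC.
by rewrite addrCA.
Qed.

HB.instance Definition _ := GRing.isSubmodClosed.Build R (V -> R^o)
  continuous_functional continuous_functional_submod.

Record dual := Dual {
  dual_fun :> V -> R^o ;
  _ : dual_fun \in continuous_functional }.

HB.instance Definition _ := [isSub for dual_fun].
HB.instance Definition _ := [Choice of dual by <:].
HB.instance Definition _ := [SubChoice_isSubLmodule of dual by <:].

Definition dual_norm (f : dual) : R :=
  sup [set `|f x| | x in [set x : V | `|x| <= 1]].

Lemma dual_linear (f : dual) : linear f.
Proof. by case: f => f /= /asboolP[]. Qed.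

Lemma dual_continuous (f : dual) : continuous f.
Proof. by case: f => f /= /asboolP[]. Qed.

Lemma dual_bounded (f : dual) :
  has_sup [set `|f x| | x in [set x : V | `|x| <= 1]].
Proof.
split; first by exists `|f 0|; exists 0 => //=; rewrite normr0 ler01.
pose g := GRing.isLinear.Build R V R^o *:%R f (dual_linear f).
pose h : {linear V -> R^o} := HB.pack (f : V -> R^o) g.
have /linear_bounded_continuous/bounded_funP/(_ 1)[M hM] : continuous h.
  exact: dual_continuous.
by exists M => _ [x /hM fx <-].
Qed.

Lemma le_dual_norm (f : dual) (x : V) : `|x| <= 1 -> `|f x| <= dual_norm f.
Proof.
by move=> x1; apply: (sup_upper_bound (dual_bounded f)); exists x.
Qed.

Lemma dual_norm_le (f : dual) (M : R) :
  (forall x : V, `|x| <= 1 -> `|f x| <= M) -> dual_norm f <= M.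
Proof.
move=> fM; apply: ge_sup; first by case: (dual_bounded f).
by move=> _ [x x1 <-]; exact: fM.
Qed.

Lemma dual_norm_ge0 (f : dual) : 0 <= dual_norm f.
Proof.
by rewrite (le_trans _ (@le_dual_norm f 0 _)) // normr0 ler01.
Qed.

Lemma dualZ (f : dual) (a : R) (x : V) : f (a *: x) = a * f x.
Proof.
have fl := dual_linear f.
have f0 : f 0 = 0.
  by have := fl (-1) 0 0; rewrite scaler0 addr0 scaleN1r addNr.
by have := fl a x 0; rewrite f0 !addr0.
Qed.

Lemma dual_normD (f g : dual) : dual_norm (f + g) <= dual_norm f + dual_norm g.
Proof.
apply: dual_norm_le => x x1; rewrite (le_trans (ler_normD _ _))//.
by rewrite lerD// le_dual_norm.
Qed.

Lemma dual_normZ (a : R) (f : dual) : dual_norm (a *: f) = `|a| * dual_norm f.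
Proof.
have le_normZ b (g : dual) : dual_norm (b *: g) <= `|b| * dual_norm g.
  apply: dual_norm_le => x x1.
  by rewrite [leLHS]normrM ler_wpM2l// le_dual_norm.
apply/eqP; rewrite eq_le le_normZ/=.
have [->|a0] := eqVneq a 0; first by rewrite normr0 mul0r dual_norm_ge0.
rewrite -ler_pdivlMl ?normr_gt0// -normfV.
by rewrite -{1}(scale1r f) -(mulVf a0) -scalerA.
Qed.

Lemma dual_norm0_eq0 (f : dual) : dual_norm f = 0 -> f = 0.
Proof.
move=> f0; apply/val_inj/funext => x /=.
have [->|x0] := eqVneq x 0; first by rewrite -(scale0r 0) dualZ mul0r.
have := @le_dual_norm f (`|x|^-1 *: x).
rewrite f0 normfZV// => /(_ (lexx _)); rewrite normr_le0 dualZ.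
by rewrite mulf_eq0 invr_eq0 normr_eq0 (negbTE x0) => /eqP.
Qed.

HB.instance Definition _ := Lmodule_isNormed.Build R dual
  dual_normD dual_normZ dual_norm0_eq0.
End dual_space.

Definition reflexive_space {R : realType} (V : normedModType R) :=
  forall Phi : dual (dual V), exists x : V, forall f : dual V, Phi f = f x.

Section weak_convergence.
Context {R : realType} {V : normedModType R}.
Implicit Types (u : nat -> V) (l : V) (phi : nat -> nat).

Definition weak_cvg u l :=
  forall f : dual V, f (u n) @[n --> \oo] --> f l.

Definition extraction phi := {homo phi : m n / (m < n)%N}.

Definition weakly_precompact u :=
  forall phi, extraction phi ->
    exists psi l, extraction psi /\ weak_cvg (u \o phi \o psi) l.

Definition weak_limit_point u l :=
  exists2 phi, extraction phi & weak_cvg (u \o phi) l.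

Definition weakly_lsc (r : V -> R) :=
  forall u l, weak_cvg u l -> ((r l)%:E <= limn_einf (EFin \o r \o u))%E.

Definition coercive (r : V -> R) :=
  forall A : R, exists M : R, forall x : V, M <= `|x| -> A <= r x.

End weak_convergence.

(* The power V^k with the max norm; a type alias, so as not to interfere with
   the product topology carried by function types. *)
Section power_space.
Context {R : realType} (V : normedModType R) (k : nat).

Definition power_space : Type := 'I_k -> V.

HB.instance Definition _ := GRing.Lmodule.copy power_space ('I_k -> V).

Definition power_norm (mu : power_space) : R := \big[Num.max/0]_(j < k) `|mu j|.

Lemma power_normD (mu nu : power_space) :
  power_norm (mu + nu) <= power_norm mu + power_norm nu.
Proof.
apply/bigmax_leP; split=> [|j _].
  by rewrite addr_ge0// /power_norm bigmax_idl le_max lexx.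
by rewrite (le_trans (ler_normD _ _))// lerD// /power_norm le_bigmax.
Qed.

Lemma power_normZ (a : R) (mu : power_space) :
  power_norm (a *: mu) = `|a| * power_norm mu.
Proof.
rewrite /power_norm; elim/big_ind2 : _ => [|x y z t -> ->|j _].
- by rewrite mulr0.
- by rewrite maxr_pMr.
- by rewrite normrZ.
Qed.

Lemma power_norm0_eq0 (mu : power_space) : power_norm mu = 0 -> mu = 0.
Proof.
move=> mu0; apply/funext => j; apply/eqP; rewrite -normr_le0 -[leRHS]mu0.
exact: le_bigmax.
Qed.

HB.instance Definition _ := Lmodule_isNormed.Build R power_space
  power_normD power_normZ power_norm0_eq0.
End power_space.

Notation borel X := (g_sigma_algebraType (@open X)).

(* When X is second countable, the intersection below is itself a closed set
   with P-null complement, hence the smallest one. *)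
Definition measure_support {R : realType} {X : ptopologicalType}
    (P : probability (borel X) R) : set X :=
  \bigcap_(F in [set F : set X | closed F /\ P (~` F) = 0%E]) F.

Definition mutually_independent {R : realType} {d d' : measure_display}
    {Omega : measurableType d} {T : measurableType d'}
    (PP : probability Omega R) (xi : nat -> Omega -> T) :=
  forall (J : seq nat) (A : nat -> set T), uniq J ->
    (forall i, measurable (A i)) ->
    PP (\bigcap_(i in [set` J]) (xi i @^-1` A i)) =
    (\prod_(i <- J) PP (xi i @^-1` A i))%E.

Definition minimizer {R : realType} {T : Type} (f : T -> R) (x : T) :=
  forall y, f x <= f y.

Definition is_minimum {R : realType} {T : Type} (f : T -> R) (m : R) :=
  exists2 x, minimizer f x & f x = m.

Section objectives.
Context {R : realType} {X Y : normedModType R} {k : nat}.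
Variables (d : X -> Y -> R) (r : power_space Y k.+1 -> R) (lambda : R).
Implicit Types mu : power_space Y k.+1.

Definition min_dist (x : X) mu : R :=
  \big[Num.min/d x (mu ord0)]_(j < k.+1) d x (mu j).

Definition empirical_objective (xi : nat -> X) (n : nat) mu : R :=
  n%:R^-1 * (\sum_(i < n) min_dist (xi i) mu) + lambda * r mu.

Definition limit_objective (P : probability (borel X) R) mu : R :=
  (\int[P]_x min_dist x mu) + lambda * r mu.

End objectives.

(* Main.v *)
From HB Require Import structures.
Require Import Defs.
From mathcomp Require Import all_boot all_order all_algebra.
From mathcomp Require Import all_classical all_reals all_analysis.
From mathcomp Require Import measurable_realfun zify ring lra.

Import Order.TTheory GRing.Theory Num.Theory.
Import numFieldNormedType.Exports.

Local Open Scope classical_set_scope.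
Local Open Scope ring_scope.

(** The space Z of k-tuples of centres is again a separable reflexive Banach
space, and everything takes place there, with
g x z = min_dist d x z as loss. By lower semicontinuity of r and
coercivity the sublevel sets of r are weakly sequentially compact, and every
competitor of bounded energy lies in such a set because lambda * r is part of
both objectives. So the theorem is the fundamental theorem of
Gamma-convergence for equicoercive functionals (minima_convergence), as soon
as almost surely
- along weakly convergent sequences of bounded penalty, the lower limit of the
  sample objectives is at least the population objective of the limit
  (sample_objective_liminf);
- on one countable family of tuples that is minimizing for the population
  objective, the sample objectives converge to the population objective.

The second point is the strong law of large numbers, applied countably many
times. The first quantifies over uncountably many sequences, and Wald's device
reduces it to countably many applications of the same law. On a sublevel set of
r the weak topology is described by a sequence of functionals separating the
points of Z, so one can choose countably many weakly compact boxes that shrink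
to any given point. For a box U the lower envelope x |-> inf of g x over U is
lower semicontinuous, because g is jointly lower semicontinuous and U is
compact; it is therefore Borel, and capped at a constant it is bounded, hence
its sample means converge to its integral. A sequence weakly convergent to nu
eventually lies in each box around nu, so its sample means are eventually at
least those of the envelope; and when the boxes shrink to nu the integrals of
the envelopes tend to the integral of g x nu, by dominated convergence
(integral_lower_envelope_cvg). The same argument
yields a minimizer of the population objective, as the weak limit of sample
minimizers.

Three classical facts support this. Weak sequential compactness
(bounded_weakly_convergent_subsequence) takes a weak limit along an ultrafilter,
which exists by reflexivity, and uses separating functionals, provided by the
Hahn-Banach theorem, to replace the ultrafilter by a subsequence. The strong law
for bounded functions (strong_law_bounded) is obtained from the variance of the
means along squares. That the support carries the whole mass
(support_compl_negligible) makes each g x z essentially bounded in x. *)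

Set Implicit Arguments.
Unset Strict Implicit.
Unset Printing Implicit Defensive.

(** * Hahn-Banach by minimal sublinear functionals *)

Section hahn_banach.
Context {R : realType} {V : lmodType R}.
Implicit Types (p q : V -> R) (x y : V).

Definition sublinear q :=
  (forall x y, q (x + y) <= q x + q y) /\
  (forall a x, 0 <= a -> q (a *: x) = a * q x).

Lemma sublinear_oppr q x : sublinear q -> - q (- x) <= q x.
Proof.
move=> [qD qZ]; have := qD x (- x); rewrite subrr.
have := qZ 0 0 (lexx _); rewrite scale0r mul0r => ->; lra.
Qed.

(** The best upper bound for the value at x of a functional below q, sublinear, and
equal to q at y: the construction that makes q smaller unless q is additive in
the direction y. *)
Definition ray_descent q y x : R := inf [set q (x + t *: y) - t * q y | t in [set t | 0 <= t]].

Let ray_descent_lb q y x : sublinear q ->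
  lbound [set q (x + t *: y) - t * q y | t in [set t | 0 <= t]] (- q (- x)).
Proof.
move=> [qD qZ] _ [t /= t0 <-]; rewrite -qZ//.
by have := qD (- x) (x + t *: y); rewrite addKr; lra.
Qed.

Lemma ray_descent_le_at q y x (t c : R) : sublinear q -> 0 <= t ->
  q (x + t *: y) - t * q y <= c -> ray_descent q y x <= c.
Proof.
move=> sq t0; apply: le_trans; apply: ge_inf; last by exists t.
by exists (- q (- x)); exact: ray_descent_lb.
Qed.

Lemma ray_descent_ge q y x (c : R) :
  (forall t, 0 <= t -> c <= q (x + t *: y) - t * q y) -> c <= ray_descent q y x.
Proof.
move=> h; apply: lb_le_inf; last by move=> _ [t /= t0 <-]; exact: h.
by exists (q (x + 0 *: y) - 0 * q y), 0 => //=.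
Qed.

Lemma sublinear_ray_descent q y : sublinear q -> sublinear (ray_descent q y).
Proof.
move=> sq; have [qD qZ] := sq.
have q0 : q 0 = 0 by have := qZ 0 0 (lexx _); rewrite scale0r mul0r.
split=> [x x'|a x].
  rewrite -lerBlDr; apply: ray_descent_ge => t t0.
  rewrite lerBlDr -lerBlDl; apply: ray_descent_ge => s s0.
  rewrite lerBlDr; apply: (@ray_descent_le_at _ _ _ (t + s)) => //; first exact: addr_ge0.
  have := qD (x + t *: y) (x' + s *: y).
  by rewrite addrACA -scalerDl mulrDl; lra.
rewrite le_eqVlt => /predU1P[<-|a0].
  rewrite scale0r mul0r; apply/eqP; rewrite eq_le; apply/andP; split.
    by apply: (@ray_descent_le_at _ _ _ 0) => //; rewrite scale0r addr0 q0 mul0r subr0.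
  by apply: ray_descent_ge => t t0; rewrite add0r qZ// subrr.
apply/eqP; rewrite eq_le; apply/andP; split.
  rewrite -ler_pdivrMl//; apply: ray_descent_ge => t t0; rewrite ler_pdivrMl//.
  apply: (@ray_descent_le_at _ _ _ (a * t)) => //; first by rewrite mulr_ge0// ltW.
  by rewrite -scalerA -scalerDr qZ ?(ltW a0)//; lra.
apply: ray_descent_ge => t t0; rewrite -ler_pdivlMl//.
apply: (@ray_descent_le_at _ _ _ (a^-1 * t)) => //.
  by rewrite mulr_ge0// invr_ge0 ltW.
rewrite -[x](scalerK (lt0r_neq0 a0)) -scalerA -scalerDr qZ ?invr_ge0 ?(ltW a0)//.
by rewrite scalerK ?gt_eqF//; lra.
Qed.

Lemma ray_descent_le q y x : sublinear q -> ray_descent q y x <= q x.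
Proof.
by move=> sq; apply: (@ray_descent_le_at _ _ _ 0) => //; rewrite scale0r addr0 mul0r subr0.
Qed.

(** Minimality forces ray_descent q y = q; taking t = 1 in the infimum gives
q x + q y <= q (x + y), so q is additive. *)
Lemma minimal_sublinear_linear q : sublinear q ->
  (forall q', sublinear q' -> (forall x, q' x <= q x) -> q' = q) ->
  forall a x y, q (a *: x + y) = a * q x + q y.
Proof.
move=> sq qmin; have [qD qZ] := sq.
have qadd x y : q (x + y) = q x + q y.
  apply/eqP; rewrite eq_le qD/=.
  have <- : ray_descent q y = q.
    by apply: qmin => [|z]; [exact: sublinear_ray_descent|exact: ray_descent_le].
  rewrite -lerBrDr; apply: (@ray_descent_le_at _ _ _ 1) => //.
  have -> : ray_descent q y = q.
    by apply: qmin => [|z]; [exact: sublinear_ray_descent|exact: ray_descent_le].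
  by rewrite scale1r mul1r.
have q0 : q 0 = 0 by have := qZ 0 0 (lexx _); rewrite scale0r mul0r.
have qN x : q (- x) = - q x.
  by apply/eqP; rewrite -addr_eq0 -qadd addNr q0.
move=> a x y; rewrite qadd; congr (_ + _).
have [a0|a0] := leP 0 a; first exact: qZ.
by rewrite -[a *: x]opprK -scaleNr qN qZ ?oppr_ge0 1?ltW// mulNr opprK.
Qed.

(** Zorn's lemma gives a minimal sublinear functional below p: the pointwise infimum
of a chain is finite since s x >= - p (- x) for every sublinear s <= p. *)
Lemma linear_below_sublinear p : sublinear p ->
  exists2 f : V -> R, (forall a x y, f (a *: x + y) = a * f x + f y) &
    forall x, f x <= p x.
Proof.
move=> sp.
pose T := {q : V -> R | sublinear q /\ forall x, q x <= p x}.
pose rel (s t : T) := `[< forall x, sval t x <= sval s x >].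
have [| | | |[q [sq qp]] qmax] := @Zorn T rel.
- by move=> t; apply/asboolP.
- move=> a b c /asboolP ab /asboolP bc; apply/asboolP => x.
  exact: le_trans (bc x) (ab x).
- move=> [a pa] [b pb] /asboolP/= ab /asboolP/= ba; apply: eq_exist.
  by apply/funext => x; apply/eqP; rewrite eq_le ab ba.
- move=> A Atot.
  have [->|/set0P[s0 As0]] := eqVneq A set0.
    by exists (exist _ p (conj sp (fun x => lexx _))).
  pose m x := inf [set sval s x | s in A].
  have lb x : has_lbound [set sval s x | s in A].
    exists (- p (- x)) => _ [[s [ss sp']] _ <-] /=.
    by apply: le_trans (sublinear_oppr x ss); rewrite lerN2.
  have mle x (s : T) : A s -> m x <= sval s x.
    by move=> As; apply: ge_inf => //; exists s.
  have mge x c : (forall s : T, A s -> c <= sval s x) -> c <= m x.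
    move=> h; apply: lb_le_inf; first by exists (sval s0 x), s0.
    by move=> _ [s As <-]; exact: h.
  have sm : sublinear m.
    split=> [x y|a x a0].
      rewrite -lerBlDr; apply: (mge) => s As.
      rewrite lerBlDr -lerBlDl; apply: (mge) => t At; rewrite lerBlDr.
      have [u [Au us ut]] : exists u : T, [/\ A u, forall x, sval u x <= sval s x
          & forall x, sval u x <= sval t x].
        by have [/asboolP|/asboolP] := Atot _ _ As At; [exists t|exists s].
      apply: (le_trans (mle _ _ Au)); have [[uD _] _] := svalP u; rewrite addrC.
      by apply: le_trans (uD _ _) _; rewrite lerD.
    apply/eqP; rewrite eq_le; apply/andP; split; last first.
      apply: (mge) => s As; have [[_ sZ] _] := svalP s; rewrite sZ//.
      by rewrite ler_wpM2l// mle.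
    move: a0; rewrite le0r => /orP[/eqP ->|a0].
      rewrite mul0r; apply: le_trans (mle _ _ As0) _.
      by have [[_ sZ] _] := svalP s0; rewrite sZ// mul0r.
    rewrite -ler_pdivrMl//; apply: (mge) => s As; rewrite ler_pdivrMl//.
    apply: le_trans (mle _ _ As) _; have [[_ sZ] _] := svalP s.
    by rewrite sZ// ltW.
  have mp x : m x <= p x.
    by apply: le_trans (mle _ _ As0) _; have [_] := svalP s0; exact.
  exists (exist _ m (conj sm mp)) => s As; apply/asboolP => x /=; exact: mle.
- exists q => //; apply: minimal_sublinear_linear => // q' sq' q'q.
  have q'p x : q' x <= p x by exact: le_trans (q'q x) (qp x).
  have := qmax (exist _ q' (conj sq' q'p)).
  by move=> /(_ _)/(congr1 sval)/= ->//; apply/asboolP.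
Qed.

End hahn_banach.

(** * Continuous functionals *)

Section dual_facts.
Context {R : realType} {V : normedModType R}.
Implicit Types (f : dual V) (x y : V).

Lemma dualD f x y : f (x + y) = f x + f y.
Proof. by have := dual_linear f 1 x y; rewrite !scale1r. Qed.

Lemma dualN f x : f (- x) = - f x.
Proof. by rewrite -scaleN1r dualZ mulN1r. Qed.

Lemma dualB f x y : f (x - y) = f x - f y.
Proof. by rewrite dualD dualN. Qed.

Lemma dual0 f : f 0 = 0.
Proof. by have := dualZ f 0 0; rewrite scaler0 mul0r. Qed.

Lemma dual_le f x : `|f x| <= dual_norm f * `|x|.
Proof.
have [->|x0] := eqVneq x 0.
  by rewrite dual0 !normr0 mulr0.
have := @le_dual_norm _ _ f (`|x|^-1 *: x).
rewrite normfZV// => /(_ (lexx _)); rewrite dualZ normrM ger0_norm ?invr_ge0//.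
by rewrite ler_pdivrMl ?normr_gt0// mulrC.
Qed.

Lemma dual_build (f : V -> R) (M : R) :
    (forall a x y, f (a *: x + y) = a * f x + f y) ->
    (forall x, `|f x| <= M * `|x|) ->
  exists g : dual V, forall x, g x = f x.
Proof.
move=> fL fM.
have fB x y : f x - f y = f (x - y).
  by rewrite [x - y]addrC -(scaleN1r y) fL mulN1r addrC.
have fc : (f : V -> R^o) \in @continuous_functional R V.
  apply/asboolP; split => // x; apply/cvgrPdist_lt => e e0.
  near=> y; rewrite fB (le_lt_trans (fM _))//.
  rewrite (@le_lt_trans _ _ ((`|M| + 1) * `|x - y|))//.
    by rewrite ler_wpM2r// (le_trans (ler_norm _))// lerDl.
  rewrite -ltr_pdivlMl ?ltr_wpDl//; near: y.
  by apply: cvgr_dist_lt => //; rewrite mulr_gt0// invr_gt0 ltr_wpDl.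
by exists (Dual fc).
Unshelve. all: by end_near. Qed.

(** A linear form below ray_descent of the norm in the direction z is below the norm
and, by t = 1 in the infimum, at most - |z| at - z. *)
Lemma norming_functional z :
  exists f : dual V, (forall x, `|f x| <= `|x|) /\ f z = `|z|.
Proof.
have sN : sublinear (fun x : V => `|x|).
  split=> [x y|a x a0]; first exact: ler_normD.
  by rewrite normrZ ger0_norm.
have [f fL fp] := linear_below_sublinear (sublinear_ray_descent z sN).
have f0 : f 0 = 0 by have := fL 1 0 0; rewrite scaler0 addr0; lra.
have fN x : f (- x) = - f x.
  by have := fL (-1) x 0; rewrite scaleN1r !addr0 f0; lra.
have fle x : f x <= `|x| by apply: le_trans (fp _) (ray_descent_le _ _ sN).
have fabs x : `|f x| <= `|x|.
  by rewrite ler_norml fle andbT lerNl -fN -normrN fle.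
have [g gf] := @dual_build f 1 fL (fun x => ltac:(rewrite mul1r; exact: fabs)).
exists g; split=> [x|]; rewrite gf//.
apply/eqP; rewrite eq_le fle/= -[leRHS]opprK lerNr -fN.
apply: le_trans (fp _) _; apply: (@ray_descent_le_at _ _ _ _ _ 1) => //.
by rewrite scale1r addNr normr0 mul1r sub0r.
Qed.

End dual_facts.

Section separable_space.
Context {R : realType} {V : normedModType R}.
Hypothesis sepV : separable V.

Lemma dense_sequence :
  exists s : nat -> V, forall x (e : R), 0 < e -> exists n, `|x - s n| < e.
Proof.
have [D Dc Dd] := sepV.
(* the dense set is nonempty, as the whole space is open and contains 0 *)
have [d0 [_ Dd0]] := Dd setT (ex_intro _ 0 I) openT.
have /pfcard_geP[D0|[s]] : (D #<= [set: nat])%card by exact: Dc.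
  by move: Dd0; rewrite D0.
exists s => x e e0.
have [y [xy Dy]] := Dd (ball x e) (ex_intro _ x (ballxx x e0)) (ball_open x e).
have [n _ sny] := 'surj_s Dy.
by exists n; rewrite sny; move: xy; rewrite -ball_normE.
Qed.

End separable_space.

(** * Weak sequential compactness *)

(** Choosing m beyond all earlier choices at each step turns a property that holds
for arbitrarily large indices into an extraction. *)
Lemma extraction_choice (P : nat -> nat -> Prop) :
    (forall n N, exists2 m, (N <= m)%N & P n m) ->
  exists2 phi, extraction phi & forall n, P n (phi n).
Proof.
move=> h; pose next n N := sval (cid2 (h n N)).
have next_le n N : (N <= next n N)%N by rewrite /next; case: cid2.
have nextP n N : P n (next n N) by rewrite /next; case: cid2.
pose phi := fix phi n := if n is n'.+1 then next n (phi n').+1 else next 0%N 0%N.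
exists phi; last by case=> [|n] /=; exact: nextP.
by apply: homo_ltn; [exact: ltn_trans|move=> n /=; exact: next_le].
Qed.

Lemma extraction_ge phi n : extraction phi -> (n <= phi n)%N.
Proof.
by move=> phiP; elim: n => // n ih; apply: (leq_ltn_trans ih); exact: phiP.
Qed.

Lemma extraction_cvg phi : extraction phi -> phi @ \oo --> \oo.
Proof.
move=> phiP A [N _ NA]; exists N => // n /= Nn; apply: NA => /=.
by rewrite (leq_trans Nn)// extraction_ge.
Qed.

Lemma not_eventually_extraction (P : nat -> Prop) :
  ~ (\forall n \near \oo, P n) -> exists2 phi, extraction phi & forall n, ~ P (phi n).
Proof.
move=> nP; apply: (@extraction_choice (fun _ m => ~ P m)) => _ N.
apply: contrapT => h; apply: nP; exists N => // m /= Nm.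
by apply: contrapT => Pm; apply: h; exists m.
Qed.

Lemma ultrafilter_cvg_bounded {R : realType} {T : Type} (U : set_system T)
    (a : T -> R) (B : R) : UltraFilter U -> (forall n, `|a n| <= B) ->
  exists l : R, a @ U --> l.
Proof.
move=> UF aB.
have cB : compact [set` `[- B, B]] by exact: segment_compact.
have aU : (a @ U) [set` `[- B, B]].
  by apply: (@filterS _ U _ setT) => [n _|]; [rewrite /= in_itv/= -ler_norml|exact: filterT].
have [l [_ lU]] := cB (a @ U) _ aU.
exists l => N lN /=.
have [//|/= UN] := in_ultra_setVsetC (a @^-1` N) UF.
by have [z [zN /zN]] := lU (~` N) N UN lN.
Qed.

Section weak_compactness.
Context {R : realType} {V : normedModType R}.

(** The limits of f (u n) along U depend linearly and boundedly on f, hence form an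
element of the bidual, which reflexivity identifies with a point of V. *)
Lemma ultrafilter_weak_limit (U : set_system nat) (u : nat -> V) (B : R) :
    reflexive_space V -> UltraFilter U -> (forall n, `|u n| <= B) ->
  exists l, forall f : dual V, f (u n) @[n --> U] --> f l.
Proof.
move=> reflV UF uB.
have fuB (f : dual V) n : `|f (u n)| <= B * `|f|.
  rewrite mulrC; apply: le_trans (dual_le _ _) _.
  by rewrite ler_wpM2l// dual_norm_ge0.
have /choice[L LP] (f : dual V) : exists l : R, f (u n) @[n --> U] --> l.
  exact: (@ultrafilter_cvg_bounded _ _ _ (fun n => f (u n)) _ _ (fuB f)).
have [||Phi PhiE] := @dual_build R (dual V) L B.
- move=> a f g; have := LP (a *: f + g).
  have : (a *: f + g) (u n) @[n --> U] --> (a * L f + L g).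
    by apply: cvgD (LP g); apply: cvgMl_tmp; exact: LP.
  by move=> /cvg_unique/[apply]-> //.
- move=> f.
  have nL : `|f (u n)| @[n --> U] --> `|L f| by exact: cvg_norm (LP f).
  by apply: (cvgr_to_le nL); apply: nearW => n; exact: fuB.
have [l lP] := reflV Phi.
by exists l => f; rewrite -lP PhiE.
Qed.

(** Functionals norming the points of a dense sequence: if all of them vanish at x,
then |s n| = |e n (s n)| = |e n (x - s n)| is small as soon as s n is close
to x, so x itself is small. *)
Lemma separating_functionals : separable V ->
  exists e : nat -> dual V, forall x, (forall n, e n x = 0) -> x = 0.
Proof.
move=> /dense_sequence[s sP].
have /choice[e eP] n := norming_functional (s n).
exists e => x ex0; apply/eqP; rewrite -normr_eq0 eq_le normr_ge0 andbT.
apply/ler_addgt0Pr => eps eps0; rewrite add0r.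
have [n xsn] := sP x (eps / 2) (divr_gt0 eps0 (ltr0n _ 2)).
have [le_e esn] := eP n.
have : `|s n| <= `|x - s n|.
  rewrite -esn (le_trans (ler_norm _))//.
  have -> : e n (s n) = - e n (x - s n) by rewrite dualB ex0 sub0r opprK.
  by rewrite normrN.
have := ler_normD (x - s n) (s n); rewrite subrK; lra.
Qed.

(** A weak limit l along an ultrafilter U exists by reflexivity, and since the sets
of U are infinite one extracts a subsequence along which every e i converges
to e i l. Any weak limit along U of a further subsequence has the same values
under all e i, so it is l; this rules out a functional f and a further
subsequence on which f stays away from f l. *)
Lemma bounded_weakly_convergent_subsequence (u : nat -> V) (B : R) :
    separable V -> reflexive_space V -> (forall n, `|u n| <= B) ->
  exists phi l, extraction phi /\ weak_cvg (u \o phi) l.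
Proof.
move=> sepV reflV uB; have [e esep] := separating_functionals sepV.
have [U [UF ooU]] := @ultraFilterLemma nat \oo _.
have [l lP] := ultrafilter_weak_limit reflV UF uB.
pose close n m := forall i, (i < n)%N -> `|e i (l - u m)| < n.+1%:R^-1.
have [n N|phi phiP phic] := @extraction_choice close.
  have Uc : U (close n).
    suff : \forall m \near U, forall i : 'I_n, `|e i (l - u m)| < n.+1%:R^-1.
      by apply: filterS => m h i ni; exact: (h (Ordinal ni)).
    apply: filter_forall => i.
    have n1 : 0 < n.+1%:R^-1 :> R by rewrite invr_gt0.
    have /cvgrPdist_lt/(_ _ n1) := lP (e i).
    by apply: filterS => m; rewrite dualB.
  have /ooU UN : \oo [set m | (N <= m)%N] by exists N.
  by have [m [cm Nm]] := filter_ex (filterI Uc UN); exists m.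
exists phi, l; split => // f; apply: contrapT => nf.
have [eps eps0 neps] : exists2 eps, 0 < eps &
    ~ \forall n \near \oo, `|f l - f (u (phi n))| < eps.
  apply: contrapT => h; apply: nf; apply/cvgrPdist_lt => eps eps0.
  by apply: contrapT => h'; apply: h; exists eps.
(* psi is an extraction along which f stays at distance at least eps *)
have [psi psiP psieps] := not_eventually_extraction neps.
have [l' l'P] := ultrafilter_weak_limit reflV UF (fun n => uB (phi (psi n))).
have ll' : l = l'.
  apply/eqP; rewrite -subr_eq0; apply/eqP/esep => i; rewrite dualB.
  apply/eqP; rewrite subr_eq0; apply/eqP.
  apply: (cvg_unique _ _ (l'P (e i))) => //.
  have : e i (u (phi (psi n))) @[n --> \oo] --> e i l.
    apply/cvgrPdist_lt => d d0.
    near=> n; rewrite -dualB.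
    have h : `|e i (l - u (phi (psi n)))| < (psi n).+1%:R^-1.
      apply: phic; apply: leq_trans (extraction_ge n psiP).
      by near: n; exact: nbhs_infty_gt.
    apply: (lt_trans h).
    rewrite (@le_lt_trans _ _ n.+1%:R^-1)//.
      by rewrite lef_pV2 ?posrE// ler_nat ltnS extraction_ge.
    by near: n; exact: (near_infty_natSinv_lt (PosNum d0)).
  by move=> h; apply: cvg_trans h; exact: cvg_app ooU.
have : \forall n \near U, `|f l - f (u (phi (psi n)))| < eps.
  by have /cvgrPdist_lt/(_ _ eps0) := l'P f; rewrite ll'.
by move=> /filter_ex[n /psieps].
Unshelve. all: by end_near. Qed.

End weak_compactness.

(** * Finite powers of a reflexive separable space *)

Section dual_operations.
Context {R : realType} {V : normedModType R}.
Implicit Types f g : dual V.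

Lemma dual_ext f g : (forall x, f x = g x) -> f = g.
Proof. by move=> fg; apply/val_inj/funext. Qed.

Lemma dual_addE f g x : (f + g) x = f x + g x.
Proof. by []. Qed.

Lemma dual_scaleE a f x : (a *: f) x = a * f x.
Proof. by []. Qed.

Lemma dual_sum (I : Type) (s : seq I) (P : pred I) f (v : I -> V) :
  f (\sum_(i <- s | P i) v i) = \sum_(i <- s | P i) f (v i).
Proof.
elim/big_rec2 : _ => [|i y x _ <-]; first exact: dual0.
by rewrite dualD.
Qed.

Lemma dual_sumE (I : Type) (s : seq I) (P : pred I) (f : I -> dual V) x :
  (\sum_(i <- s | P i) f i) x = \sum_(i <- s | P i) f i x.
Proof. by elim/big_rec2 : _ => [//|i y g _ <-]; rewrite dual_addE. Qed.

End dual_operations.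

Section power_space_weak.
Context {R : realType} {V : normedModType R} {k : nat}.
Local Notation Z := (power_space V k).
Implicit Types (mu : Z) (j : 'I_k).

Lemma le_power_norm mu j : `|mu j| <= `|mu|.
Proof. exact: le_bigmax. Qed.

Lemma power_norm_le mu (B : R) : 0 <= B -> (forall j, `|mu j| <= B) -> `|mu| <= B.
Proof. by move=> B0 h; apply/bigmax_leP. Qed.

Lemma power_norm_lt mu (B : R) : 0 < B -> (forall j, `|mu j| < B) -> `|mu| < B.
Proof. by move=> B0 h; apply/bigmax_ltP. Qed.

Lemma power_proj (f : dual V) j : exists F : dual Z, forall mu, F mu = f (mu j).
Proof.
apply: (@dual_build R Z (fun mu => f (mu j)) (dual_norm f)).
  by move=> a x y; rewrite dualD dualZ.
move=> mu; apply: le_trans (dual_le _ _) _.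
by rewrite ler_wpM2l ?dual_norm_ge0// le_power_norm.
Qed.

Definition power_inj j (y : V) : Z := fun i => if i == j then y else 0.

Lemma power_injD a j x y :
  power_inj j (a *: x + y) = a *: power_inj j x + power_inj j y.
Proof.
apply/funext => i; rewrite /power_inj !fctE.
by case: ifP => // _; rewrite scaler0 addr0.
Qed.

Lemma power_inj_sum mu : mu = \sum_j power_inj j (mu j).
Proof.
apply/funext => i; rewrite fct_sumE (bigD1 i)//= /power_inj eqxx.
by rewrite big1 ?addr0// => j /negbTE; rewrite eq_sym => ->.
Qed.

Lemma power_restr (F : dual Z) j :
  exists f : dual V, forall y, f y = F (power_inj j y).
Proof.
apply: (@dual_build R V (fun y => F (power_inj j y)) (dual_norm F)).
  by move=> a x y; rewrite power_injD dualD dualZ.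
move=> y; apply: le_trans (dual_le _ _) _.
rewrite ler_wpM2l ?dual_norm_ge0//; apply: power_norm_le => // i.
by rewrite /power_inj; case: ifP => // _; rewrite normr0.
Qed.

(** A functional on the power is the sum of its restrictions to the factors, so an
element of its bidual is determined by one element of the bidual of V for each
coordinate. *)
Lemma power_space_reflexive : reflexive_space V -> reflexive_space Z.
Proof.
move=> reflV Phi.
have /choice[pr prE] (p : dual V * 'I_k) :=  power_proj p.1 p.2.
have prL j a f g : pr (a *: f + g, j) = a *: pr (f, j) + pr (g, j).
  by apply: dual_ext => mu; rewrite dual_addE dual_scaleE !prE.
have /choice[mu muE] j : exists y : V, forall f : dual V, Phi (pr (f, j)) = f y.
  have [||Psi PsiE] := @dual_build R (dual V) (fun f => Phi (pr (f, j))) (dual_norm Phi).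
  - by move=> a f g; rewrite prL dualD dualZ.
  - move=> f; apply: le_trans (dual_le _ _) _.
    rewrite ler_wpM2l ?dual_norm_ge0//; apply: dual_norm_le => x x1.
    by rewrite prE/= le_dual_norm// (le_trans (le_power_norm _ _)).
  by have [y yE] := reflV Psi; exists y => f; rewrite -yE PsiE.
exists mu => F; have /choice[re reE] := power_restr F.
have -> : F = \sum_j pr (re j, j).
  apply: dual_ext => x; rewrite {1}(power_inj_sum x) dual_sum dual_sumE.
  by apply: eq_bigr => j _; rewrite prE reE.
rewrite dual_sum dual_sumE.
by apply: eq_bigr => j _; rewrite muE prE.
Qed.

Lemma power_space_separable : separable V -> separable Z.
Proof.
move=> /dense_sequence[s sP].
exists (range (fun (c : {ffun 'I_k -> nat}) => (fun j => s (c j)) : Z)).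
  by apply: (sub_countable (card_image_le _ _)); exact: countableP.
move=> O [x Ox]; rewrite openE => /(_ x Ox).
move=> /nbhs_ballP[e /= e0 eO].
have /choice[c cP] (j : 'I_k) := sP (x j) e e0.
exists (fun j => s (c j)); split; last first.
  by exists [ffun j => c j] => //; apply/funext => j; rewrite ffunE.
apply: eO; rewrite -ball_normE /=; apply: power_norm_lt => // j; exact: cP.
Qed.

Lemma weak_cvg_component (u : nat -> Z) (l : Z) j :
  weak_cvg u l -> weak_cvg (fun n => u n j) (l j).
Proof.
move=> ul f; have [F FE] := power_proj f j.
by rewrite -FE; under eq_fun do rewrite -FE; exact: ul.
Qed.

End power_space_weak.

(** * Independence and integrals of products *)

Section bounded_measurable.
Context {d} {T : measurableType d} {R : realType}.
Implicit Types f g : T -> R.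

(** Boundedness on the whole space keeps the class stable under products and makes
every member integrable for a probability measure. *)
Definition bounded_measurable f :=
  measurable_fun [set: T] f /\ exists B, forall x, `|f x| <= B.

Lemma bounded_measurable_cst a : bounded_measurable (fun=> a).
Proof. by split; [exact: measurable_cst|exists `|a|]. Qed.

Lemma bounded_measurableD f g : bounded_measurable f -> bounded_measurable g ->
  bounded_measurable (fun x => f x + g x).
Proof.
move=> [mf [A fA]] [mg [B gB]]; split; first exact: measurable_funD.
by exists (A + B) => x; rewrite (le_trans (ler_normD _ _))// lerD.
Qed.

Lemma bounded_measurableM f g : bounded_measurable f -> bounded_measurable g ->
  bounded_measurable (fun x => f x * g x).
Proof.
move=> [mf [A fA]] [mg [B gB]]; split; first exact: measurable_funM.
by exists (A * B) => x; rewrite normrM ler_pM.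
Qed.

Lemma bounded_measurable_sum (I : Type) (s : seq I) (F : I -> T -> R) :
  (forall i, bounded_measurable (F i)) ->
  bounded_measurable (fun x => \sum_(i <- s) F i x).
Proof.
move=> mF; elim: s => [|i s ih].
  by under eq_fun do rewrite big_nil; exact: bounded_measurable_cst.
by under eq_fun do rewrite big_cons; exact: bounded_measurableD.
Qed.

Lemma bounded_measurable_integrable (mu : {measure set T -> \bar R}) f :
  (mu [set: T] < +oo)%E -> bounded_measurable f ->
  mu.-integrable [set: T] (EFin \o f).
Proof.
move=> muT [mf [B fB]]; apply: measurable_bounded_integrable => //.
exists B; split; first exact: num_real.
by move=> M BM x _ /=; apply: le_trans (fB x) (ltW BM).
Qed.

Lemma bounded_measurable_Pintegrable (P : probability T R) f :
  bounded_measurable f -> P.-integrable [set: T] (EFin \o f).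
Proof.
by apply: bounded_measurable_integrable; rewrite [ltLHS](probability_setT P) ltry.
Qed.

End bounded_measurable.

Lemma bounded_measurable_comp {d d'} {T : measurableType d}
    {T' : measurableType d'} {R : realType} (f : T -> R) (phi : T' -> T) :
  bounded_measurable f -> measurable_fun [set: T'] phi ->
  bounded_measurable (fun x => f (phi x)).
Proof.
by move=> [mf [B fB]] mphi; split; [exact: measurableT_comp|exists B].
Qed.

Section independent_pair.
Context {d d'} {Omega : measurableType d} {T : measurableType d'} {R : realType}.
Variables (PP : probability Omega R) (P : probability T R).

(** The joint law of (X, Y) agrees with P \x P on rectangles, hence everywhere, and
the integral of f p.1 * g p.2 against the product splits by Fubini. *)
Lemma Rintegral_independentM (X Y : {RV PP >-> T}) (f g : T -> R) :
  (forall A, measurable A -> distribution PP X A = P A) ->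
  (forall A, measurable A -> distribution PP Y A = P A) ->
  (forall A B, measurable A -> measurable B ->
    PP (X @^-1` A `&` Y @^-1` B) = (PP (X @^-1` A) * PP (Y @^-1` B))%E) ->
  bounded_measurable f -> bounded_measurable g ->
  \int[PP]_w (f (X w) * g (Y w)) = (\int[P]_x f x) * (\int[P]_x g x).
Proof.
move=> XP YP XY fb gb.
have mXY : measurable_fun [set: Omega] (fun w => (X w, Y w)).
  by apply/measurable_fun_pairP; split.
pose XYm := isMeasurableFun.Build _ _ _ _ (fun w => (X w, Y w)) mXY.
pose XY' : {RV PP >-> (T * T)%type} := HB.pack (fun w => (X w, Y w)) XYm.
have Fb : bounded_measurable (fun p : T * T => f p.1 * g p.2).
  apply: bounded_measurableM.
    exact: (bounded_measurable_comp fb measurable_fst).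
  exact: (bounded_measurable_comp gb measurable_snd).
have [mF _] := Fb.
have mf : P.-integrable [set: T] (EFin \o f) by exact: bounded_measurable_Pintegrable.
have mg : P.-integrable [set: T] (EFin \o g) by exact: bounded_measurable_Pintegrable.
have -> : \int[PP]_w (f (X w) * g (Y w)) =
    fine (\int[distribution PP XY']_p (f p.1 * g p.2)%:E)%E.
  congr fine; rewrite integral_pushforward//; first exact/measurable_EFinP.
  exact: (bounded_measurable_Pintegrable PP (bounded_measurable_comp Fb mXY)).
rewrite -(@eq_measure_integral _ _ _ _ _ (P \x P)%E); last first.
  move=> A mA _.
  apply: (@product_measure_unique _ _ _ _ _ P P (distribution PP XY')) => //.
  move=> B C mB mC; have := XY B C mB mC.
  rewrite -[PP (X @^-1` B)]/(distribution PP X B).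
  by rewrite -[PP (Y @^-1` C)]/(distribution PP Y C) XP// YP.
rewrite -integral12_prod_meas1/=; last first.
  apply: bounded_measurable_integrable Fb.
  rewrite -setXTT [ltLHS](product_measure1E P P measurableT measurableT).
  by have := probability_setT P; rewrite /= => ->; rewrite mule1 ltry.
rewrite /fubini_F/=.
have inner x : (\int[P]_y (f x * g y)%:E = (f x * \int[P]_y g y)%:E)%E.
  rewrite -RintegralZl// /Rintegral fineK//.
  apply: (integrable_fin_num measurableT).
  apply: bounded_measurable_Pintegrable.
  by apply: bounded_measurableM => //; exact: bounded_measurable_cst.
by under eq_integral do rewrite inner; exact: RintegralZr.
Qed.

End independent_pair.

(** * The strong law of large numbers for bounded functions *)

Lemma square_bracket n : exists m, (m * m <= n < m.+1 * m.+1)%N.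
Proof.
elim: n => [|n [m /andP[mn nm]]]; first by exists 0%N.
have [h|h] := leqP (m.+1 * m.+1) n.+1; last by exists m; rewrite h andbT ltnW.
by exists m.+1; rewrite h /=; lia.
Qed.

(** Consecutive squares differ by 2 m + 1, negligible against m * m, so the partial
sums of a bounded sequence cannot move much between two squares. *)
Lemma average_cvg0_squares (R : realType) (x : nat -> R) (C : R) :
    (forall i, `|x i| <= C) ->
    (m.+1 * m.+1)%:R^-1 * (\sum_(i < m.+1 * m.+1) x i) @[m --> \oo] --> 0 ->
  n%:R^-1 * (\sum_(i < n) x i) @[n --> \oo] --> 0.
Proof.
move=> xC sq; pose S n := \sum_(i < n) x i.
have C0 : 0 <= C by rewrite (le_trans _ (xC 0%N)).
have SB a b : (a <= b)%N -> `|S b| <= `|S a| + (b - a)%:R * C.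
  move=> ab; rewrite -{1}(subnKC ab); elim: (b - a)%N => [|c ih].
    by rewrite addn0 mul0r addr0.
  rewrite addnS /S big_ord_recr/= (le_trans (ler_normD _ _))//.
  by rewrite -[c.+1]addn1 natrD mulrDl mul1r addrA lerD.
apply/cvgrPdist_lt => e e0.
have e2 : 0 < e / 2 by rewrite divr_gt0.
move/cvgrPdist_lt : sq => /(_ _ e2) [M _ MP].
have [K] : exists K : nat, 2 * C / (e / 2) < K%:R.
  exists (Num.truncn (2 * C / (e / 2))).+1; exact: truncnS_gt.
rewrite ltr_pdivrMr// => KP.
exists ((M + K).+1 * (M + K).+1)%N => // n /= Nn.
have [m /andP[mn nm]] := square_bracket n.
have Mm : (M + K < m)%N by rewrite ltnNge; apply/negP => mM; nia.
case: m => // m in mn nm Mm *.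
rewrite sub0r normrN normrM normfV normr_nat ltr_pdivrMl; last first.
  by rewrite ltr0n (leq_trans _ Nn).
have := MP m; rewrite /= => /(_ ltac:(lia)).
rewrite sub0r normrN normrM normfV normr_nat ltr_pdivrMl ?ltr0n// => Sm.
rewrite (le_lt_trans (SB _ _ mn))//.
have h1 : (n - m.+1 * m.+1)%:R * C <= (2 * m.+1)%:R * C.
  by rewrite ler_wpM2r// ler_nat; nia.
have h2 : (2 * m.+1)%:R * C <= (m.+1 * m.+1)%:R * (e / 2).
  rewrite !natrM -mulrA mulrCA -mulrA ler_wpM2l// ltW// (lt_le_trans KP)//.
  by rewrite ler_wpM2r ?(ltW e2)// ler_nat; lia.
have h3 : (m.+1 * m.+1)%:R * e <= n%:R * e by rewrite ler_wpM2r ?(ltW e0)// ler_nat.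
lra.
Qed.

(** Telescoping: 1 / a ^ 2 <= 2 / a - 2 / (a + 1) for a >= 1. *)
Lemma sum_inv_squares_le (R : realType) n :
  \sum_(m < n) (m.+1%:R ^+ 2)^-1 <= 2 :> R.
Proof.
suff : \sum_(m < n) (m.+1%:R ^+ 2)^-1 <= 2 - 2 / n.+1%:R :> R.
  by move/le_trans; apply; rewrite gerBl divr_ge0.
elim: n => [|n ih]; first by rewrite big_ord0 divr1 subrr.
rewrite big_ord_recr/= (le_trans (lerD ih (lexx _)))//.
have a0 : 0 < n.+1%:R :> R by [].
have -> : n.+2%:R = n.+1%:R + 1 :> R by rewrite -natr1.
have a1 : 1 <= n.+1%:R :> R by rewrite ler1n.
move: (n.+1%:R) a0 a1 => a a0 a1.
rewrite -subr_ge0.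
have -> : 2 - 2 / (a + 1) - (2 - 2 / a + (a ^+ 2)^-1) =
  (a - 1) / (a ^+ 2 * (a + 1)) by field; lra.
by rewrite divr_ge0 ?subr_ge0// mulr_ge0 ?sqr_ge0//; lra.
Qed.

Section strong_law.
Context {d d'} {Omega : measurableType d} {T : measurableType d'} {R : realType}.
Variables (PP : probability Omega R) (P : probability T R).

(** The sum of the series has finite integral, so it is finite almost everywhere and
its terms tend to 0 there. *)
Lemma ae_cvg0_summable (f : nat -> Omega -> R) (B : R) :
    (forall n, bounded_measurable (f n)) -> (forall n w, 0 <= f n w) ->
    (forall n, \sum_(m < n) \int[PP]_w f m w <= B) ->
  {ae PP, forall w, f n w @[n --> \oo] --> 0}.
Proof.
move=> fb f0 fB.
have mf n : measurable_fun [set: Omega] (fun w => (f n w)%:E).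
  by apply/measurable_EFinP; case: (fb n).
pose F w := (\sum_(n <oo) (f n w)%:E)%E.
have F0 w : (0 <= F w)%E by apply: nneseries_ge0 => n _ _; rewrite lee_fin.
have mF : measurable_fun [set: Omega] F.
  by apply: (@ge0_emeasurable_sum _ _ _ setT _ xpredT) => // n w _ _; rewrite lee_fin.
have intF : PP.-integrable [set: Omega] F.
  apply/integrableP; split=> //.
  under eq_integral do rewrite gee0_abs//.
  rewrite /F integral_nneseries//; last by move=> n w _; rewrite lee_fin.
  apply: (@le_lt_trans _ _ B%:E); last exact: ltry.
  apply: lime_le.
    by apply: is_cvg_nneseries => n _ _; apply: integral_ge0 => w _; rewrite lee_fin.
  apply: nearW => n; rewrite big_mkord.
  rewrite (_ : (\sum_(i < n) _)%E = (\sum_(i < n) \int[PP]_w f i w)%:E) ?lee_fin//.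
  rewrite -sumEFin; apply: eq_bigr => i _; rewrite /Rintegral fineK//.
  apply: (integrable_fin_num measurableT).
  exact: (bounded_measurable_Pintegrable PP (fb i)).
have := integrable_ae measurableT intF.
apply: filterS => w /(_ I) Ffin.
apply: cvg_series_cvg_0; apply: nondecreasing_is_cvgn.
  by apply/nondecreasing_seqP => n; rewrite seriesSr lerDl.
exists (fine (F w)) => _ [n _ <-]; rewrite -lee_fin fineK//.
rewrite /series/= -sumEFin; apply: nneseries_lim_ge => i _ _.
by rewrite lee_fin.
Qed.

Variable xi : nat -> {RV PP >-> T}.
Hypothesis xi_law :
  forall i A, measurable A -> distribution PP (xi i) A = P A.
Hypothesis xi_indep : mutually_independent PP (fun i => xi i : Omega -> T).

Lemma mutually_independent_pair (i j : nat) (A B : set T) : (i == j) = false ->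
  measurable A -> measurable B ->
  PP (xi i @^-1` A `&` xi j @^-1` B) =
  (PP (xi i @^-1` A) * PP (xi j @^-1` B))%E.
Proof.
move=> ij mA mB.
have := @xi_indep [:: i; j] (fun k => if k == i then A else B).
rewrite /= inE ij => /(_ isT); rewrite !big_cons big_nil mule1 eqxx.
rewrite eq_sym ij => <-; last by move=> k; case: ifP.
congr (PP _); apply/seteqP; split=> w /=.
  move=> [Aw Bw] k; rewrite /= !inE => /orP[/eqP->|/eqP->]; first by rewrite eqxx.
  by rewrite eq_sym ij.
move=> h; split; first by have := h i; rewrite /= inE eqxx; exact.
by have := h j; rewrite /= !inE eqxx orbT eq_sym ij; exact.
Qed.

Section centered.
Variables (g : T -> R) (C : R).
Hypotheses (mg : measurable_fun [set: T] g) (gC : forall x, `|g x| <= C).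
Hypothesis (g_mean : \int[P]_x g x = 0).

Let S n w := \sum_(i < n) g (xi i w).

Let gb : bounded_measurable g. Proof. by split=> //; exists C. Qed.

Let gxib i : bounded_measurable (fun w => g (xi i w)).
Proof. exact: (bounded_measurable_comp gb). Qed.

Let Sb n : bounded_measurable (S n).
Proof. exact: bounded_measurable_sum. Qed.

Lemma centered_uncorrelated n k : (n <= k)%N -> \int[PP]_w (S n w * g (xi k w)) = 0.
Proof.
elim: n => [|n ih] nk.
  rewrite /S; under eq_Rintegral do rewrite big_ord0 mul0r.
  by rewrite Rintegral_cst// mul0r.
rewrite /S; under eq_Rintegral do rewrite big_ord_recr/= mulrDl.
rewrite RintegralD//.
- have indep A B (mA : measurable A) (mB : measurable B) :=
    mutually_independent_pair (ltn_eqF nk) mA mB.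
  rewrite ih 1?ltnW// add0r.
  by rewrite (Rintegral_independentM (@xi_law n) (@xi_law k) indep gb gb) g_mean mul0r.
- by apply: bounded_measurable_Pintegrable; exact: bounded_measurableM (Sb n) (gxib k).
- by apply: bounded_measurable_Pintegrable; exact: bounded_measurableM.
Qed.

(** Pairwise independence kills the cross terms, so the second moment grows linearly
and not quadratically. *)
Lemma centered_second_moment n : \int[PP]_w (S n w * S n w) <= n%:R * C ^+ 2.
Proof.
elim: n => [|n ih].
  rewrite /S; under eq_Rintegral do rewrite big_ord0 mul0r.
  by rewrite Rintegral_cst// !mul0r.
have E w : S n.+1 w * S n.+1 w = S n w * S n w + 2 * (S n w * g (xi n w)) +
    g (xi n w) * g (xi n w).
  by rewrite /S big_ord_recr/=; ring.
under eq_Rintegral do rewrite E.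
have b1 : bounded_measurable (fun w => S n w * S n w) by apply: bounded_measurableM.
have b2 : bounded_measurable (fun w => S n w * g (xi n w)) by apply: bounded_measurableM.
have b3 : bounded_measurable (fun w => g (xi n w) * g (xi n w)).
  exact: bounded_measurableM.
have b4 : bounded_measurable (fun w => 2 * (S n w * g (xi n w))).
  by apply: bounded_measurableM => //; exact: bounded_measurable_cst.
have b5 : bounded_measurable (fun w => S n w * S n w + 2 * (S n w * g (xi n w))).
  exact: bounded_measurableD.
rewrite RintegralD//; try exact: bounded_measurable_Pintegrable.
rewrite RintegralD//; try exact: bounded_measurable_Pintegrable.
rewrite RintegralZl//; try exact: bounded_measurable_Pintegrable.
rewrite centered_uncorrelated// mulr0 addr0 -natr1 mulrDl mul1r lerD//.
rewrite (@le_trans _ _ (\int[PP]_w C ^+ 2))//.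
  apply: le_Rintegral => //; try exact: bounded_measurable_Pintegrable.
    by apply: bounded_measurable_Pintegrable; exact: bounded_measurable_cst.
  by move=> w _; rewrite -expr2 -real_normK ?num_real// lerXn2r ?nnegrE// (le_trans _ (gC (xi n w))).
by rewrite Rintegral_cst//= probability_setT mulr1.
Qed.

(** Along the squares n = m ^ 2 the means have second moment at most C ^ 2 / m ^ 2,
which is summable; between squares average_cvg0_squares takes over. *)
Lemma strong_law_centered :
  {ae PP, forall w, n%:R^-1 * (\sum_(i < n) g (xi i w)) @[n --> \oo] --> 0}.
Proof.
(* the squared mean over the first (m + 1) ^ 2 terms *)
pose f m w := ((m.+1 * m.+1)%:R^-1 * S (m.+1 * m.+1) w) ^+ 2.
have fb m : bounded_measurable (f m).
  have hb : bounded_measurable (fun w => (m.+1 * m.+1)%:R^-1 * S (m.+1 * m.+1) w).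
    by apply: bounded_measurableM => //; exact: bounded_measurable_cst.
  exact: (bounded_measurableM hb hb).
have fE m : \int[PP]_w f m w <= C ^+ 2 * (m.+1%:R ^+ 2)^-1.
  have E w : f m w = (m.+1%:R ^+ 2)^-1 ^+ 2 *
      (S (m.+1 * m.+1) w * S (m.+1 * m.+1) w).
    by rewrite /f exprMn -natrX mulnn -expr2.
  under eq_Rintegral do rewrite E.
  rewrite RintegralZl//; last first.
    by apply: bounded_measurable_Pintegrable; exact: bounded_measurableM.
  apply: le_trans (ler_wpM2l _ (centered_second_moment _)) _.
    by rewrite exprn_ge0// invr_ge0 exprn_ge0.
  rewrite natrM; have : m.+1%:R != 0 :> R by [].
  move: (m.+1%:R : R) => a a0; rewrite le_eqVlt; apply/orP; left; apply/eqP.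
  by field.
have := @ae_cvg0_summable f (C ^+ 2 * 2) fb (fun _ _ => sqr_ge0 _).
have h n : \sum_(m < n) \int[PP]_w f m w <= C ^+ 2 * 2.
  rewrite (@le_trans _ _ (\sum_(m < n) C ^+ 2 * (m.+1%:R ^+ 2)^-1))//.
    by apply: ler_sum => i _; exact: fE.
  rewrite -mulr_sumr.
  by rewrite ler_wpM2l ?sqr_ge0// sum_inv_squares_le.
move=> /(_ h); apply: filterS => w fw.
apply: (@average_cvg0_squares _ (fun i => g (xi i w)) C) => //.
apply/cvgrPdist_lt => e e0; move/cvgrPdist_lt : fw => /(_ _ (exprn_gt0 2 e0)).
apply: filterS => m; rewrite !sub0r !normrN normrX ltr_pXn2r ?nnegrE ?normr_ge0//.
exact: ltW.
Qed.

End centered.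

Lemma strong_law_bounded (h : T -> R) : bounded_measurable h ->
  {ae PP, forall w,
    n%:R^-1 * (\sum_(i < n) h (xi i w)) @[n --> \oo] --> \int[P]_x h x}.
Proof.
move=> hb; set mean := \int[P]_x h x.
have [mg [C gC]] : bounded_measurable (fun x => h x - mean).
  by apply: bounded_measurableD => //; exact: bounded_measurable_cst.
have g0 : \int[P]_x (h x - mean) = 0.
  rewrite RintegralB//; try exact: bounded_measurable_Pintegrable.
    by rewrite Rintegral_cst//= probability_setT mulr1 subrr.
  by apply: bounded_measurable_Pintegrable; exact: bounded_measurable_cst.
have := strong_law_centered mg gC g0; apply: filterS => w hw.
apply/subr_cvg0; apply: cvg_trans hw; apply: near_eq_cvg.
exists 1%N => // n /= n1.
rewrite big_split/= sumr_const card_ord mulrDr; congr (_ + _).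
by rewrite -[- mean *+ n]mulr_natl mulKf// pnatr_eq0 -lt0n.
Qed.

End strong_law.

(** * The support of a Borel probability measure *)

Section support.
Context {R : realType} {X : normedModType R}.
Variable P : probability (borel X) R.
Hypothesis sepX : separable X.

Lemma open_borel_measurable (U : set X) : open U -> measurable (U : set (borel X)).
Proof. by move=> oU; apply: sub_sigma_algebra. Qed.

(** Around each point outside the support there is a null ball, which contains a
smaller ball with centre in a dense sequence and radius 1 / (q + 1) around that
point; there are countably many of the latter. *)
Lemma support_compl_negligible : P.-negligible (~` measure_support P : set (borel X)).
Proof.
have [s sP] := dense_sequence sepX.
pose B n q : set X := ball (s n) (q.+1%:R^-1 : R).
have mB n q : measurable (B n q : set (borel X)).
  by apply: open_borel_measurable; exact: ball_open.
pose G n q : set (borel X) := if P (B n q) == 0%E then B n q else set0.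
have G0 n q : P.-negligible (G n q).
  rewrite /G; case: ifPn => [/eqP P0|_]; last exact: negligible_set0.
  by exists (B n q); split=> //; exact: mB.
have : P.-negligible (\bigcup_n \bigcup_q G n q).
  by apply: negligible_bigcup => n; exact: negligible_bigcup.
apply: negligibleS => x /existsNP[F] /not_implyP[[cF PF] nFx].
have : nbhs x (~` F) by apply: open_nbhs_nbhs; split => //; exact: closed_openC.
move=> /nbhs_ballP[e /= e0 eF].
have [q qe] : exists q, q.+1%:R^-1 < e / 2.
  have e2 : 0 < e / 2 by rewrite divr_gt0.
  exact: filter_ex (near_infty_natSinv_lt (PosNum e2)).
have q0 : 0 < q.+1%:R^-1 :> R by rewrite invr_gt0.
have [n xsn] := sP x _ q0.
exists n => //; exists q => //; rewrite /G ifT.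
  by rewrite /B -ball_normE /= distrC.
rewrite -measure_le0 -PF; apply: le_measure; rewrite ?inE//.
  by apply: open_borel_measurable; exact: closed_openC.
move=> y; rewrite /B -ball_normE /= => sny; apply: eF; rewrite -ball_normE /=.
rewrite (le_lt_trans (ler_distD (s n) _ _))// (lt_trans (ltrD xsn sny))//.
by rewrite [ltRHS]splitr ltrD.
Qed.

Context {disp : measure_display} {Omega : measurableType disp}.
Variable PP : probability Omega R.
Variable xi : nat -> {RV PP >-> borel X}.
Hypothesis xi_law : forall i (A : set (borel X)), measurable A ->
  distribution PP (xi i) A = P A.
Hypothesis xi_indep : mutually_independent PP (fun i => xi i : Omega -> borel X).

Lemma ae_sample_in_support :
  {ae PP, forall w, forall i, measure_support P (xi i w)}.
Proof.
apply: ae_foralln => i; have [N [mN PN sN]] := support_compl_negligible.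
exists (xi i @^-1` N); split.
- by rewrite -[X in measurable X]setTI; apply: measurable_funP.
- by rewrite -PN -(xi_law i mN).
- by move=> w /sN.
Qed.

Definition bounded_on_support (h : X -> R) :=
  exists T, forall x, measure_support P x -> h x <= T.

Section bounded_on_support.
Variable h : X -> R.
Hypotheses (mh : measurable_fun [set: borel X] (h : borel X -> R)).
Hypotheses (h_ge0 : forall x, 0 <= h x) (h_bounded : bounded_on_support h).

Let truncation : exists2 h' : borel X -> R, bounded_measurable h' &
  forall x, measure_support P x -> h' x = h x.
Proof.
have [T hT] := h_bounded.
exists (fun x => Num.min (h x) T); last by move=> x /hT hx; rewrite min_l.
split; first by apply: measurable_minr => //; exact: measurable_cst.
exists `|T| => x; have [hxT|Thx] := leP (h x) T => //.
by rewrite ger0_norm// (le_trans hxT)// ler_norm.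
Qed.

(** Capping h at its bound on the support changes neither its integral nor, almost
surely, its values on the sample. *)
Lemma strong_law_support : {ae PP, forall w,
  n%:R^-1 * (\sum_(i < n) h (xi i w)) @[n --> \oo] -->
  (\int[P]_x (h : borel X -> R) x : R)}.
Proof.
have [h' h'b hh'] := truncation.
have -> : \int[P]_x (h : borel X -> R) x = \int[P]_x h' x.
  congr fine; apply: ae_eq_integral => //; first exact/measurable_EFinP.
    by apply/measurable_EFinP; case: h'b.
  apply: negligibleS support_compl_negligible => x /= /not_implyP[_ hx] sx.
  by apply: hx; rewrite hh'.
have := strong_law_bounded xi_law xi_indep h'b.
apply: filterS2 ae_sample_in_support => w sw.
by under eq_fun do under eq_bigr do rewrite hh'//.
Qed.

End bounded_on_support.

End support.

(** * Convergence of minima *)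

Section weak_direct_method.
Context {R : realType} {Z : normedModType R}.
Hypotheses (sepZ : separable Z) (reflZ : reflexive_space Z).

(** Weak sequential lower semicontinuity written with strict lower bounds, a form that
passes to finite sums by splitting the slack between the terms. *)
Definition seq_wlsc (F : Z -> R) :=
  forall u l a, weak_cvg u l -> a < F l -> \forall n \near \oo, a < F (u n).

Lemma weakly_lsc_seq_wlsc (r : Z -> R) : weakly_lsc r -> seq_wlsc r.
Proof.
move=> rlsc u l a ul al.
have : (a%:E < limn_einf (EFin \o r \o u))%E.
  by apply: lt_le_trans (rlsc _ _ ul); rewrite lte_fin.
rewrite /limn_einf -/(limf_einf _ _) limf_einfE => /ereal_sup_gt[_ [A ooA <-]] aA.
apply: filterS ooA => n An; rewrite -lte_fin (lt_le_trans aA)//.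
by apply: ereal_inf_lbound; exists n.
Qed.

Lemma seq_wlsc_le (F : Z -> R) u l c : seq_wlsc F -> weak_cvg u l ->
  (forall n, F (u n) <= c) -> F l <= c.
Proof.
move=> Flsc ul uc; rewrite leNgt; apply/negP => /(Flsc _ _ _ ul)/filter_ex[n].
by rewrite ltNge uc.
Qed.

Variables (r : Z -> R).
Hypotheses (r_lsc : seq_wlsc r) (r_coercive : coercive r).

(** Coercivity bounds the sequence in norm, and lower semicontinuity keeps the weak
limit in the sublevel set. *)
Lemma sublevel_weakly_compact (u : nat -> Z) (B : R) : (forall n, r (u n) <= B) ->
  exists phi l, [/\ extraction phi, weak_cvg (u \o phi) l & r l <= B].
Proof.
move=> uB; have [M MP] := r_coercive (B + 1).
have uM n : `|u n| <= M.
  rewrite leNgt; apply/negP => /ltW /MP; rewrite leNgt => /negP; apply.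
  by rewrite (le_lt_trans (uB n))// ltrDl.
have [phi [l [phiP ul]]] := bounded_weakly_convergent_subsequence sepZ reflZ uM.
by exists phi, l; split=> //; apply: (seq_wlsc_le r_lsc ul) => n; exact: uB.
Qed.

Variable lambda : R.
Hypothesis lambda_gt0 : 0 < lambda.

(** The direct method: a minimizing sequence has bounded penalty, and F is at most
the infimum at a weak limit of it. *)
Lemma wlsc_minimizer (F : Z -> R) : (forall z, 0 <= F z) ->
  (forall z, lambda * r z <= F z) -> seq_wlsc F -> exists z, minimizer F z.
Proof.
move=> F0 rF Flsc; pose V := inf (range F).
have FV z : V <= F z.
  by apply: ge_inf; [exists 0 => _ [y _ <-]; exact: F0|exists z].
have hV : has_inf (range F).
  by split; [exists (F 0), 0|exists 0 => _ [y _ <-]; exact: F0].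
have /choice[u uP] n : exists z, F z < V + n.+1%:R^-1.
  have [|_ [z _ <-] zV] := @inf_adherent _ (range F) n.+1%:R^-1 _ hV.
    by rewrite invr_gt0.
  by exists z.
have ub n : r (u n) <= lambda^-1 * (V + 1).
  rewrite ler_pdivlMl// (le_trans (rF _))// (le_trans (ltW (uP n)))// lerD2l.
  by rewrite invf_le1// ler1n.
have [phi [l [phiP ul _]]] := sublevel_weakly_compact ub.
exists l => z; apply: le_trans (FV z); rewrite leNgt; apply/negP => VF.
have d0 : 0 < (F l - V) / 2 by rewrite divr_gt0// subr_gt0.
have aF : V + (F l - V) / 2 < F l by lra.
have := Flsc _ _ _ ul aF => h1.
have h2 := near_infty_natSinv_lt (PosNum d0).
have [n [/= nF nd]] := filter_ex (filterI h1 h2).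
have := lt_trans nF (uP (phi n)); rewrite ltrD2l ltNge => /negP; apply.
rewrite (le_trans _ (ltW nd))// lef_pV2 ?posrE//.
by rewrite ler_nat ltnS extraction_ge.
Qed.

Section gamma_convergence.
Variables (f : nat -> Z -> R) (F : Z -> R) (nu : nat -> Z).
Hypothesis f_pen : forall n z, lambda * r z <= f n z.
Hypothesis f_liminf : forall phi u l B a, extraction phi -> weak_cvg u l ->
  (forall n, r (u n) <= B) -> a < F l -> \forall n \near \oo, a < f (phi n) (u n).
Hypothesis f_recovery : forall k, f n (nu k) @[n --> \oo] --> F (nu k).
Hypothesis nu_minimizing : forall z e, 0 < e -> exists k, F (nu k) < F z + e.

Section minimizers.
Variable mu : nat -> Z.
Hypothesis mu_min : forall n, (0 < n)%N -> minimizer (f n) (mu n).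

(** For large n the minimum is at most f n (nu 0), which is close to F (nu 0); the
finitely many other indices, among them 0 where nothing is known of mu, only
enlarge the bound. *)
Lemma minimizers_penalty_bounded : exists B, forall n, r (mu n) <= B.
Proof.
have [N _ NP] : \forall n \near \oo, f n (nu 0%N) < F (nu 0%N) + 1.
  by apply: (cvgr_lt _ (@f_recovery 0%N)); rewrite ltrDl.
exists (Num.max (lambda^-1 * (F (nu 0%N) + 1)) (\big[Num.max/0]_(i < N.+1) r (mu i))).
move=> n; rewrite le_max; have [nN|Nn] := leqP n N.
  by apply/orP; right; exact: (@le_bigmax _ _ _ _ (fun i : 'I_N.+1 => r (mu i)) (Ordinal (nN : (n < N.+1)%N))).
apply/orP; left; rewrite ler_pdivlMl// (le_trans (f_pen n _))//.
rewrite (le_trans (mu_min _ (nu 0%N)))//; first by rewrite (leq_ltn_trans _ Nn).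
by apply: ltW; apply: NP; exact: ltnW.
Qed.

Lemma minimizers_weakly_precompact : weakly_precompact mu.
Proof.
move=> phi phiP; have [B muB] := minimizers_penalty_bounded.
have [psi [l [psiP mul _]]] := @sublevel_weakly_compact (mu \o phi) B (fun n => muB (phi n)).
by exists psi, l.
Qed.

(** The half of the convergence that only uses the recovery sequence: minimal values
are asymptotically at most any F (nu k). *)
Lemma f_minimizers_lt k e : 0 < e ->
  \forall n \near \oo, f n (mu n) < F (nu k) + e.
Proof.
move=> e0; have h1 : \forall n \near \oo, f n (nu k) < F (nu k) + e.
  by apply: (cvgr_lt _ (@f_recovery k)); rewrite ltrDl.
have h2 : \forall n \near \oo, (0 < n)%N by exists 1%N.
apply: filterS2 h1 h2 => n fn n0; apply: le_lt_trans fn; exact: mu_min.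
Qed.

Lemma weak_limit_minimizer phi l : extraction phi -> weak_cvg (mu \o phi) l ->
  minimizer F l.
Proof.
move=> phiP mul z; have [B muB] := minimizers_penalty_bounded.
apply/ler_addgt0Pr => e e0; rewrite leNgt; apply/negP => zl.
have e2 : 0 < e / 2 by rewrite divr_gt0.
have [k kz] := nu_minimizing z e2.
have h1 := f_liminf phiP mul (fun n => muB (phi n)) zl.
have h2 := extraction_cvg phiP (f_minimizers_lt k e2).
have [n [/= n1 n2]] := filter_ex (filterI h1 h2).
move: (lt_trans n1 n2); lra.
Qed.

(** If f n (mu n) stayed below F l - e along an extraction, a further extraction of mu
would converge weakly to some l' and the lower bound would give F l' < F l. *)
Lemma minimum_values_cvg l : minimizer F l -> f n (mu n) @[n --> \oo] --> F l.
Proof.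
move=> lmin; apply/cvgrPdist_lt => e e0; have [B muB] := minimizers_penalty_bounded.
have e2 : 0 < e / 2 by rewrite divr_gt0.
have [k kz] := nu_minimizing l e2.
have h1 := f_minimizers_lt k e2.
suff h2 : \forall n \near \oo, F l - e < f n (mu n).
  apply: filterS2 h1 h2 => n n1 n2; rewrite ltr_distlC; apply/andP; split => //.
  by lra.
apply: contrapT => /not_eventually_extraction[phi phiP phiF].
have [psi [l' [psiP mul' _]]] := @sublevel_weakly_compact (mu \o phi) B (fun n => muB (phi n)).
have pp : extraction (phi \o psi) by move=> m n mn; apply: phiP; exact: psiP.
have Fl' : F l - e < F l' by apply: lt_le_trans (lmin l'); rewrite gtrBl.
have /filter_ex[n] := f_liminf pp mul' (fun n => muB (phi (psi n))) Fl'.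
exact: phiF.
Qed.

End minimizers.

Hypothesis f_ge0 : forall n z, 0 <= f n z.
Hypothesis f_wlsc : forall n, (0 < n)%N -> seq_wlsc (f n).

(** The fundamental theorem of Gamma-convergence. The direct method gives minimizers
of each f n; the penalty makes them weakly precompact, and a weak limit of them
minimizes F. *)
Lemma minima_convergence :
  (exists (m : nat -> R) (m_oo : R),
    [/\ is_minimum F m_oo, forall n, (0 < n)%N -> is_minimum (f n) (m n) &
        m @ \oo --> m_oo]) /\
  (forall mu, (forall n, (0 < n)%N -> minimizer (f n) (mu n)) ->
     weakly_precompact mu /\
     forall l, weak_limit_point mu l -> minimizer F l).
Proof.
have /choice[mu mu_min] n : exists z, (0 < n)%N -> minimizer (f n) z.
  case: n => [|n]; first by exists 0.
  by have [z zP] := wlsc_minimizer (f_ge0 n.+1) (f_pen n.+1) (f_wlsc (ltn0Sn n)); exists z.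
split.
  have idP : extraction id by [].
  have [psi [l [psiP mul]]] := minimizers_weakly_precompact mu_min idP.
  have lmin := weak_limit_minimizer mu_min psiP mul.
  exists (fun n => f n (mu n)), (F l); split; first by exists l.
    by move=> n n0; exists (mu n) => //; exact: mu_min.
  exact: minimum_values_cvg.
move=> {mu_min}mu mu_min; split; first exact: minimizers_weakly_precompact.
by move=> l [phi phiP mul]; exact: weak_limit_minimizer mul.
Qed.

End gamma_convergence.

End weak_direct_method.

(** * Lower envelopes over weakly compact boxes *)

Section envelope.
Context {R : realType} {X Z : normedModType R}.
Hypotheses (sepZ : separable Z) (reflZ : reflexive_space Z).
Variable r : Z -> R.
Hypotheses (r_lsc : seq_wlsc r) (r_coercive : coercive r).
Variable e : nat -> dual Z.
Hypothesis e_sep : forall z, (forall n, e n z = 0) -> z = 0.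
Variable g : X -> Z -> R.
Hypothesis g_ge0 : forall x z, 0 <= g x z.
Hypothesis g_lsc : forall x z (xs : nat -> X) zs a, xs @ \oo --> x ->
  weak_cvg zs z -> a < g x z -> \forall n \near \oo, a < g (xs n) (zs n).

(** Boxes around c for the first M separating functionals; intersecting with a
sublevel set of r makes them weakly compact. The half-width 1 / (M + 1) tends to 0
when M grows, so that M alone governs the size of the box. *)
Definition weak_box (N M : nat) (c : Z) : set Z :=
  [set z | r z <= N%:R /\ forall i, (i < M)%N -> `|e i (z - c)| <= M.+1%:R^-1].

Lemma weak_box_compact N M c (u : nat -> Z) : (forall n, weak_box N M c (u n)) ->
  exists phi l, [/\ extraction phi, weak_cvg (u \o phi) l & weak_box N M c l].
Proof.
move=> uB; have ur n : r (u n) <= N%:R by have [] := uB n.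
have [phi [l [phiP ul rl]]] := sublevel_weakly_compact sepZ reflZ r_lsc r_coercive ur.
exists phi, l; split=> //; split=> // i iM.
have h : `|e i (u (phi n) - c)| @[n --> \oo] --> `|e i (l - c)|.
  apply: cvg_norm; rewrite dualB; under eq_fun do rewrite dualB.
  by apply: cvgB; [exact: ul|exact: cvg_cst].
apply: (cvgr_to_le h); apply: nearW => n; have [_] := uB (phi n); exact.
Qed.

(** The cap M makes the envelope bounded and gives the infimum a meaning for an empty
box. *)
Definition lower_envelope (N M : nat) (c : Z) (x : X) : R :=
  inf ([set M%:R] `|` [set g x z | z in weak_box N M c]).

Let env_lb N M c x : has_lbound ([set M%:R] `|` [set g x z | z in weak_box N M c]).
Proof. by exists 0 => _ [->|[z _ <-]]. Qed.

Lemma lower_envelope_ge0 N M c x : 0 <= lower_envelope N M c x.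
Proof.
by apply: lb_le_inf; [exists M%:R; left|move=> _ [->|[z _ <-]]].
Qed.

Lemma lower_envelope_le_cap N M c x : lower_envelope N M c x <= M%:R.
Proof. by apply: ge_inf; [exact: env_lb|left]. Qed.

Lemma lower_envelope_le N M c x z : weak_box N M c z -> lower_envelope N M c x <= g x z.
Proof. by move=> zB; apply: ge_inf; [exact: env_lb|right; exists z]. Qed.

Lemma lower_envelope_lt N M c x a : lower_envelope N M c x < a -> a <= M%:R ->
  exists2 z, weak_box N M c z & g x z < a.
Proof.
move=> + aM; move/inf_lt => /(_ (ex_intro _ M%:R (or_introl erefl))).
by move=> [_ [->|[z zB <-]]]; [rewrite ltNge aM|exists z].
Qed.

(** If the envelope were less than some b at points xs n tending to x, with b less
than its value at x, then near-optimal points of the compact box at xs n would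
accumulate weakly at some l of the box, and joint lower semicontinuity gives
g x l <= b. *)
Lemma lower_envelope_lsc N M c a : open [set x | a < lower_envelope N M c x].
Proof.
rewrite openE => x /= ax; apply: contrapT => nx.
have [b [ab bx]] : exists b, a < b /\ b < lower_envelope N M c x.
  by exists ((a + lower_envelope N M c x) / 2); split; lra.
have /choice[xs xsP] n : exists y, `|x - y| < n.+1%:R^-1 /\ lower_envelope N M c y < b.
  apply: contrapT => h; apply: nx; apply/nbhs_ballP; exists n.+1%:R^-1 => /=.
    by rewrite invr_gt0.
  move=> y; rewrite -ball_normE /= => xy; rewrite ltNge; apply/negP => ya.
  by apply: h; exists y; split=> //; exact: le_lt_trans ab.
have xsx : xs @ \oo --> x.
  apply/cvgrPdist_lt => d d0; near=> n; have [h _] := xsP n; apply: lt_trans h _.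
  by near: n; exact: (near_infty_natSinv_lt (PosNum d0)).
have bM : b <= M%:R by rewrite (le_trans (ltW bx))// lower_envelope_le_cap.
have /choice[zs zsP] n : exists z, weak_box N M c z /\ g (xs n) z < b.
  by have [_ h] := xsP n; have [z zB zb] := lower_envelope_lt h bM; exists z.
have [phi [l [phiP zl lB]]] := weak_box_compact (fun n => (zsP n).1).
have bgl : b < g x l by apply: lt_le_trans bx _; exact: lower_envelope_le.
have xphi : xs \o phi @ \oo --> x by apply: cvg_comp xsx; exact: extraction_cvg.
have [n] := filter_ex (g_lsc xphi zl bgl).
by rewrite ltNge => /negP; apply; apply: ltW; have [] := zsP (phi n).
Unshelve. all: by end_near. Qed.

Lemma bounded_measurable_lower_envelope N M c :
  bounded_measurable (lower_envelope N M c : borel X -> R).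
Proof.
split; last first.
  by exists M%:R => x; rewrite ger0_norm ?lower_envelope_ge0// lower_envelope_le_cap.
apply: measurability (RGenOInfty.measurableE R) _ => _ [_ [a ->] <-].
rewrite setTI; apply: open_borel_measurable.
rewrite [X in open X](_ : _ = [set x | a < lower_envelope N M c x]).
  exact: lower_envelope_lsc.
by apply/seteqP; split=> x /=; rewrite in_itv/= andbT.
Qed.

Section approximation.
Variables (nu : Z) (N : nat) (c : nat -> Z).
Hypothesis nuN : r nu <= N%:R.
Hypothesis c_nu : forall M i, (i < M)%N -> `|e i (nu - c M)| <= M.+1%:R^-1.

(** Points of the boxes where g x is less than some b < g x nu would have a weak limit;
all the separating functionals take the same value there as at nu, so the
limit is nu, against the lower semicontinuity of g x. The penalty bound N
stays fixed, which keeps these points in one weakly compact set. *)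
Lemma lower_envelope_cvg x :
  lower_envelope N M (c M) x @[M --> \oo] --> g x nu.
Proof.
have le_env M : lower_envelope N M (c M) x <= g x nu.
  by apply: lower_envelope_le; split=> // i; exact: c_nu.
apply/cvgrPdist_lt => d d0; apply: contrapT.
move=> /not_eventually_extraction[phi phiP phid].
have [b bP bg] : exists2 b, (forall n, lower_envelope N (phi n) (c (phi n)) x < b)
    & b < g x nu.
  exists (g x nu - d / 2); last by rewrite gtrBl divr_gt0.
  move=> n; have /negP := phid n; rewrite -leNgt.
  by rewrite ger0_norm ?subr_ge0//; lra.
(* indices from n0 on have their cap above b, so b is not reached by the cap *)
pose n0 := (Num.truncn b).+1.
have bn0 : b < n0%:R by exact: truncnS_gt.
pose phi' n := phi (n + n0)%N.
have phi'P n : (n + n0 <= phi' n)%N by exact: extraction_ge.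
have /choice[zs zsP] n : exists z, weak_box N (phi' n) (c (phi' n)) z /\ g x z < b.
  have [|z zB zb] := lower_envelope_lt (bP (n + n0)%N); last by exists z.
  by rewrite (le_trans (ltW bn0))// ler_nat (leq_trans _ (phi'P n))// leq_addl.
have [psi [l [psiP zl _]]] := sublevel_weakly_compact sepZ reflZ r_lsc r_coercive
  (fun n => (zsP n).1.1).
suff lnu : l = nu.
  rewrite -lnu in bg.
  have [n] := filter_ex (g_lsc (cvg_cst x) zl bg).
  by rewrite ltNge => /negP; apply; apply: ltW; have [] := zsP (psi n).
apply/eqP; rewrite -subr_eq0; apply/eqP/e_sep => i; rewrite dualB.
apply/eqP; rewrite subr_eq0; apply/eqP.
apply: (cvg_unique _ (zl (e i))) => //.
apply/cvgrPdist_lt => eps eps0; have e2 : 0 < eps / 2 by rewrite divr_gt0.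
near=> n; rewrite -dualB.
have nphi : (n <= phi' (psi n))%N.
  rewrite (leq_trans (extraction_ge n psiP))// (leq_trans _ (phi'P _))//.
  exact: leq_addr.
have iphi : (i < phi' (psi n))%N.
  by apply: leq_trans nphi; near: n; exact: nbhs_infty_gt.
have h1 : `|e i (nu - c (phi' (psi n)))| <= (phi' (psi n)).+1%:R^-1 by exact: c_nu.
have h2 : `|e i (zs (psi n) - c (phi' (psi n)))| <= (phi' (psi n)).+1%:R^-1.
  by have [[_ +] _] := zsP (psi n); exact.
have h3 : (phi' (psi n)).+1%:R^-1 <= n.+1%:R^-1 :> R.
  by rewrite lef_pV2 ?posrE// ler_nat.
have h4 : n.+1%:R^-1 < eps / 2.
  by near: n; exact: (near_infty_natSinv_lt (PosNum e2)).
rewrite -(subrKA (c (phi' (psi n)))) dualD -[c _ - _]opprB dualN.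
rewrite (le_lt_trans (ler_normB _ _))//.
rewrite (le_lt_trans (lerD (le_trans h1 h3) (le_trans h2 h3)))//.
by rewrite [ltRHS]splitr ltrD.
Unshelve. all: by end_near. Qed.

Variable P : probability (borel X) R.
Hypothesis sepX : separable X.
Hypothesis g_meas : measurable_fun [set: borel X] (fun x : borel X => g x nu).
Hypothesis g_bounded : bounded_on_support P (g^~ nu).

Lemma integral_lower_envelope_cvg :
  \int[P]_x (lower_envelope N M (c M) : borel X -> R) x @[M --> \oo] -->
  \int[P]_x (fun x : borel X => g x nu) x.
Proof.
have [T gT] := g_bounded.
have [|||||gint _ h] := @dominated_convergence _ (borel X) R P setT measurableT
  (fun M x => (lower_envelope N M (c M) x)%:E) (fun x => (g x nu)%:E) (fun=> T%:E).
- by move=> M; apply/measurable_EFinP; case: (bounded_measurable_lower_envelope N M (c M)).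
- exact/measurable_EFinP.
- apply: aeW => x _; apply/cvg_EFin; [exact: nearW|exact: lower_envelope_cvg].
- exact: bounded_measurable_Pintegrable (bounded_measurable_cst T).
- apply: negligibleS (support_compl_negligible P sepX) => x h sx; apply: h => M _.
  rewrite lee_fin ger0_norm ?lower_envelope_ge0// (le_trans _ (gT _ sx))//.
  by apply: lower_envelope_le; split=> // i; exact: c_nu.
by apply: fine_cvg; rewrite fineK//; exact: (integrable_fin_num measurableT).
Qed.

End approximation.

End envelope.

(** * Minimization of penalized sample means *)

Section sample_minimization.
Context {R : realType} {X Z : normedModType R}.
Hypotheses (sepX : separable X) (sepZ : separable Z) (reflZ : reflexive_space Z).
Variable r : Z -> R.
Hypotheses (r_ge0 : forall z, 0 <= r z).
Hypotheses (r_lsc : seq_wlsc r) (r_coercive : coercive r).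
Variable lambda : R.
Hypothesis lambda_gt0 : 0 < lambda.
Variable g : X -> Z -> R.
Hypothesis g_ge0 : forall x z, 0 <= g x z.
Hypothesis g_lsc : forall x z (xs : nat -> X) zs a, xs @ \oo --> x ->
  weak_cvg zs z -> a < g x z -> \forall n \near \oo, a < g (xs n) (zs n).

Definition sample_objective (x : nat -> X) (n : nat) (z : Z) : R :=
  n%:R^-1 * (\sum_(i < n) g (x i) z) + lambda * r z.

Lemma sample_objective_penalty x n z : lambda * r z <= sample_objective x n z.
Proof. by rewrite lerDr mulr_ge0// sumr_ge0. Qed.

Lemma sample_objective_ge0 x n z : 0 <= sample_objective x n z.
Proof.
by rewrite (le_trans _ (sample_objective_penalty x n z))// mulr_ge0// ltW.
Qed.

Lemma seq_wlscZ (a : R) (F : Z -> R) : 0 < a -> seq_wlsc F ->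
  seq_wlsc (fun z => a * F z).
Proof.
move=> a0 Flsc u l b ul; rewrite -ltr_pdivrMl// => /(Flsc _ _ _ ul).
by apply: filterS => n; rewrite ltr_pdivrMl.
Qed.

Lemma seq_wlscD (F G : Z -> R) : seq_wlsc F -> seq_wlsc G ->
  seq_wlsc (fun z => F z + G z).
Proof.
move=> Flsc Glsc u l a ul al; pose d := (F l + G l - a) / 2.
have d0 : 0 < d by rewrite divr_gt0// subr_gt0.
have h1 : F l - d < F l by rewrite gtrBl.
have h2 : G l - d < G l by rewrite gtrBl.
apply: filterS2 (Flsc _ _ _ ul h1) (Glsc _ _ _ ul h2) => n n1 n2.
by rewrite /d in n1 n2; lra.
Qed.

Lemma seq_wlsc_sum (I : Type) (s : seq I) (F : I -> Z -> R) :
  (forall i, seq_wlsc (F i)) -> seq_wlsc (fun z => \sum_(i <- s) F i z).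
Proof.
move=> Flsc; elim: s => [|i s ih].
  by move=> u l a _; rewrite big_nil => a0; apply: nearW => n; rewrite big_nil.
by under eq_fun do rewrite big_cons; exact: seq_wlscD.
Qed.

Lemma sample_objective_wlsc x n : (0 < n)%N -> seq_wlsc (sample_objective x n).
Proof.
move=> n0; apply: seq_wlscD; last exact: seq_wlscZ.
apply: seq_wlscZ; first by rewrite invr_gt0 ltr0n.
by apply: seq_wlsc_sum => i u l a ul; apply: g_lsc => //; exact: cvg_cst.
Qed.

Variable e : nat -> dual Z.
Hypothesis e_sep : forall z, (forall n, e n z = 0) -> z = 0.
Variable s : nat -> Z.
Hypothesis s_dense : forall z (d : R), 0 < d -> exists n, `|z - s n| < d.

(** Centres taken in a dense sequence make the family of boxes countable. The strict
inequality leaves room for sequences converging to nu to enter the box. *)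
Lemma dense_center (nu : Z) M :
  exists j, forall i, (i < M)%N -> `|e i (nu - s j)| < M.+1%:R^-1.
Proof.
pose K := \sum_(i < M) dual_norm (e i) + 1.
have K0 : 0 < K by rewrite ltr_wpDl// sumr_ge0// => i _; exact: dual_norm_ge0.
have d0 : 0 < M.+1%:R^-1 / K by rewrite divr_gt0// invr_gt0.
have [j jP] := s_dense nu d0; exists j => i iM.
rewrite (le_lt_trans (dual_le _ _))// (@le_lt_trans _ _ (K * `|nu - s j|))//.
  rewrite ler_wpM2r// /K (bigD1 (Ordinal iM))//= -addrA lerDl addr_ge0//.
  by rewrite sumr_ge0// => k _; exact: dual_norm_ge0.
by rewrite mulrC -ltr_pdivlMr.
Qed.

(** Finitely many strict inequalities at nu persist along a sequence converging weakly
to nu. *)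
Lemma weak_box_near N M c (nu : Z) (u : nat -> Z) :
    (forall i, (i < M)%N -> `|e i (nu - c)| < M.+1%:R^-1) ->
    weak_cvg u nu -> (forall n, r (u n) <= N%:R) ->
  \forall n \near \oo, weak_box r e N M c (u n).
Proof.
move=> cM unu uN.
suff : \forall n \near \oo, forall i : 'I_M, `|e i (u n - c)| < M.+1%:R^-1.
  by apply: filterS => n h; split=> // i iM; exact: ltW (h (Ordinal iM)).
apply: filter_forall => i.
have h : `|e i (u n - c)| @[n --> \oo] --> `|e i (nu - c)|.
  apply: cvg_norm; rewrite dualB; under eq_fun do rewrite dualB.
  by apply: cvgB; [exact: unu|exact: cvg_cst].
by apply: (cvgr_lt _ h); exact: cM.
Qed.

Variable P : probability (borel X) R.
Hypothesis g_meas :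
  forall z, measurable_fun [set: borel X] (fun x : borel X => g x z).
Hypothesis g_bounded : forall z, bounded_on_support P (g^~ z).

Definition population_objective (z : Z) : R :=
  \int[P]_x (fun x : borel X => g x z) x + lambda * r z.

Lemma population_objective_ge0 z : 0 <= population_objective z.
Proof.
by rewrite addr_ge0// ?mulr_ge0 ?(ltW lambda_gt0)// Rintegral_ge0.
Qed.

(** Wald's argument: choose a box around l whose envelope has integral nearly that of
g x l; the sequence eventually lies in the box, and there the sample means of g
dominate those of the envelope, which converge by hypothesis. *)
Lemma sample_objective_liminf (x : nat -> X) phi u l B a :
    (forall N M j, n%:R^-1 * (\sum_(i < n) lower_envelope r e g N M (s j) (x i))
      @[n --> \oo] --> \int[P]_y (lower_envelope r e g N M (s j) : borel X -> R) y) ->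
    extraction phi -> weak_cvg u l -> (forall n, r (u n) <= B) ->
    a < population_objective l ->
  \forall n \near \oo, a < sample_objective x (phi n) (u n).
Proof.
move=> slln phiP ul uB al; pose N := (Num.truncn B).+1.
have BN : B <= N%:R by apply: ltW; exact: truncnS_gt.
have uN n : r (u n) <= N%:R by exact: le_trans BN.
have lN : r l <= N%:R by exact: seq_wlsc_le ul uN.
have /choice[j jP] := dense_center l.
have c_nu M i (iM : (i < M)%N) := ltW (jP M i iM).
(* half of the slack goes to the integral, half to the penalty *)
pose del := (population_objective l - a) / 2.
have d0 : 0 < del by rewrite divr_gt0// subr_gt0.
have := integral_lower_envelope_cvg sepZ reflZ r_lsc r_coercive e_sep g_ge0 g_lsc
  lN c_nu sepX (g_meas l) (g_bounded l).
set I := \int[P]_x _ => cvgI.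
have Id : I - del < I by rewrite gtrBl.
have [M IM] := filter_ex (cvgr_gt _ cvgI _ Id).
have h1 : \forall n \near \oo, I - del < (phi n)%:R^-1 *
    (\sum_(i < phi n) lower_envelope r e g N M (s (j M)) (x i)).
  exact: extraction_cvg phiP _ (cvgr_gt _ (slln N M (j M)) _ IM).
have h2 := weak_box_near (jP M) ul uN.
have rd : lambda * r l - del < lambda * r l by rewrite gtrBl.
have h3 : \forall n \near \oo, lambda * r l - del < lambda * r (u n).
  exact: (seq_wlscZ lambda_gt0 r_lsc ul rd).
apply: filterS3 h1 h2 h3 => n /= n1 n2 n3.
have n4 : (phi n)%:R^-1 * (\sum_(i < phi n) lower_envelope r e g N M (s (j M)) (x i))
    <= (phi n)%:R^-1 * (\sum_(i < phi n) g (x i) (u n)).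
  by rewrite ler_wpM2l// ler_sum// => i _; exact: lower_envelope_le.
rewrite /sample_objective; move: (lt_le_trans n1 n4) n3.
by rewrite /del /population_objective -/I; lra.
Qed.

Lemma population_minimizing_sequence : exists nu : nat -> Z,
  forall z d, 0 < d -> exists k, population_objective (nu k) < population_objective z + d.
Proof.
pose F := population_objective; pose V := inf (range F).
have Flb : has_lbound (range F) by exists 0 => _ [y _ <-]; exact: population_objective_ge0.
have hV : has_inf (range F) by split=> //; exists (F 0), 0.
have /choice[nu nuP] n : exists z, F z < V + n.+1%:R^-1.
  have [|_ [z _ <-] zV] := @inf_adherent _ (range F) n.+1%:R^-1 _ hV.
    by rewrite invr_gt0.
  by exists z.
exists nu => z d d0; have [k kd] := filter_ex (near_infty_natSinv_lt (PosNum d0)).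
exists k; apply: lt_le_trans (nuP k) _; rewrite lerD ?(ltW kd)//.
by apply: ge_inf => //; exists z.
Qed.

Context {disp : measure_display} {Omega : measurableType disp}.
Variable PP : probability Omega R.
Variable xi : nat -> {RV PP >-> borel X}.
Hypothesis xi_law : forall i (A : set (borel X)), measurable A ->
  distribution PP (xi i) A = P A.
Hypothesis xi_indep : mutually_independent PP (fun i => xi i : Omega -> borel X).

(** The exceptional set is the union of those of countably many strong laws: one for
each term of a minimizing sequence, one for each envelope with indices N, M, j. *)
Lemma ae_minima_convergence : {ae PP, forall w,
  (exists (m : nat -> R) (m_oo : R),
    [/\ is_minimum population_objective m_oo,
        forall n, (0 < n)%N -> is_minimum (sample_objective (fun i => xi i w) n) (m n) &
        m @ \oo --> m_oo]) /\
  (forall mu, (forall n, (0 < n)%N ->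
       minimizer (sample_objective (fun i => xi i w) n) (mu n)) ->
     weakly_precompact mu /\
     forall l, weak_limit_point mu l -> minimizer population_objective l)}.
Proof.
have [nu nuP] := population_minimizing_sequence.
have lln_nu : {ae PP, forall w, forall k,
    n%:R^-1 * (\sum_(i < n) g (xi i w) (nu k)) @[n --> \oo] -->
    \int[P]_x (fun x : borel X => g x (nu k)) x}.
  apply: ae_foralln => k.
  exact: (strong_law_support sepX xi_law xi_indep (g_meas (nu k)) _ (g_bounded (nu k))).
have lln_env : {ae PP, forall w, forall N M j,
    n%:R^-1 * (\sum_(i < n) lower_envelope r e g N M (s j) (xi i w))
      @[n --> \oo] --> \int[P]_y (lower_envelope r e g N M (s j) : borel X -> R) y}.
  do 3 apply: ae_foralln => ?; apply: (strong_law_bounded xi_law xi_indep).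
  exact: bounded_measurable_lower_envelope.
apply: filterS2 lln_nu lln_env => w w_nu w_env.
apply: (@minima_convergence _ _ sepZ reflZ r r_lsc r_coercive lambda lambda_gt0 _ _ nu).
- exact: sample_objective_penalty.
- by move=> phi u l B a; exact: sample_objective_liminf.
- by move=> k; apply: cvgD; [exact: w_nu|exact: cvg_cst].
- exact: nuP.
- exact: sample_objective_ge0.
- by move=> n n0; exact: sample_objective_wlsc.
Qed.

End sample_minimization.

(** * The k-means objectives *)

Section min_dist_facts.
Context {R : realType} {X Y : normedModType R} {k : nat}.
Variable d : X -> Y -> R.
Local Notation Z := (power_space Y k.+1).

Lemma min_dist_ge0 x (mu : Z) : (forall x y, 0 <= d x y) -> 0 <= min_dist d x mu.
Proof. by move=> d0; apply/bigmin_geP; split. Qed.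

Lemma min_dist_le x (mu : Z) j : min_dist d x mu <= d x (mu j).
Proof. exact: bigmin_le_cond. Qed.

Lemma min_dist_gt x (mu : Z) a : (a < min_dist d x mu) <-> (forall j, a < d x (mu j)).
Proof.
split=> [amu j|aj]; first exact: lt_le_trans (min_dist_le x mu j).
by apply/bigmin_gtP; split.
Qed.

Lemma measurable_min_dist (mu : Z) :
  (forall y, measurable_fun [set: borel X] (fun x : borel X => d x y)) ->
  measurable_fun [set: borel X] (fun x : borel X => min_dist d x mu).
Proof.
move=> md; rewrite /min_dist; elim: (index_enum _) => [|j s ih].
  by under eq_fun do rewrite big_nil; exact: md.
by under eq_fun do rewrite big_cons; exact: measurable_minr.
Qed.

Lemma bounded_on_support_min_dist (P : probability (borel X) R) (mu : Z) :
  (forall y, ereal_sup [set (d x y)%:E | x in measure_support P] < +oo)%E ->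
  bounded_on_support P (min_dist d ^~ mu).
Proof.
move=> /(_ (mu ord0)); set S := ereal_sup _ => Soo.
exists (fine S) => x sx; apply: le_trans (min_dist_le x mu ord0) _.
have dS : ((d x (mu ord0))%:E <= S)%E by apply: ereal_sup_ubound; exists x.
rewrite -lee_fin fineK// fin_numE (lt_eqF Soo) andbT.
by rewrite gt_eqF// (lt_le_trans _ dS)// ltNye.
Qed.

(** A lower limit over the product filter bounds the diagonal from below, and a minimum
over finitely many indices exceeds a exactly when each term does. *)
Lemma min_dist_lsc :
  (forall x y (xs : nat -> X) (ys : nat -> Y),
     xs @ \oo --> x -> weak_cvg ys y ->
     ((d x y)%:E <=
        limf_einf (fun p : nat * nat => (d (xs p.1) (ys p.2))%:E)
                  (filter_prod \oo \oo))%E) ->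
  forall x (mu : Z) (xs : nat -> X) (mus : nat -> Z) a, xs @ \oo --> x ->
    weak_cvg mus mu -> a < min_dist d x mu ->
    \forall n \near \oo, a < min_dist d (xs n) (mus n).
Proof.
move=> dlsc x mu xs mus a xsx musmu /min_dist_gt amu.
suff : \forall n \near \oo, forall j, a < d (xs n) (mus n j).
  by apply: filterS => n; exact: (min_dist_gt _ _ _).2.
apply: filter_forall => j.
have : (a%:E < limf_einf (fun p : nat * nat => (d (xs p.1) (mus p.2 j))%:E)
                  (filter_prod \oo \oo))%E.
  apply: lt_le_trans (dlsc x (mu j) xs (fun n => mus n j) xsx _); first by rewrite lte_fin.
  exact: weak_cvg_component.
rewrite limf_einfE => /ereal_sup_gt[_ [A [[A1 A2] [/= oA1 oA2] A12] <-]] aA.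
apply: filterS2 oA1 oA2 => n n1 n2; rewrite -lte_fin (lt_le_trans aA)//.
by apply: ereal_inf_lbound; exists (n, n) => //; exact: A12.
Qed.

End min_dist_facts.

Theorem theorem4p6 (R : realType) (k : nat)
  (X Y : completeNormedModType R)
  (sepX : separable X) (reflX : reflexive_space X)
  (sepY : separable Y) (reflY : reflexive_space Y)
  (P : probability (borel X) R)
  (disp : measure_display) (Omega : measurableType disp)
  (PP : probability Omega R)
  (xi : nat -> {RV PP >-> borel X})
  (xi_law : forall (i : nat) (A : set (borel X)),
     measurable A -> distribution PP (xi i) A = P A)
  (xi_indep : mutually_independent PP (fun i => xi i : Omega -> borel X))
  (d : X -> Y -> R) (d_ge0 : forall x y, 0 <= d x y)
  (r : power_space Y k.+1 -> R) (r_ge0 : forall mu, 0 <= r mu)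
  (d_bounded : forall y : Y,
     (ereal_sup [set (d x y)%:E | x in measure_support P] < +oo)%E)
  (d_lsc : forall (x : X) (y : Y) (xs : nat -> X) (ys : nat -> Y),
     xs @ \oo --> x -> weak_cvg ys y ->
     ((d x y)%:E <=
        limf_einf (fun p : nat * nat => (d (xs p.1) (ys p.2))%:E)
                  (filter_prod \oo \oo))%E /\
     d (xs m) y @[m --> \oo] --> d x y)
  (d_meas : forall y : Y,
     measurable_fun [set: borel X] (fun x : borel X => d x y))
  (r_lsc : weakly_lsc r)
  (r_coercive : coercive r)
  (lambda : R) (lambda_gt0 : 0 < lambda) :
  let f_ (w : Omega) (n : nat) :=
    empirical_objective d r lambda (fun i => xi i w) n in
  let f_oo := limit_objective d r lambda P in
  {ae PP, forall w : Omega,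
     exists (m : nat -> R) (m_oo : R),
       [/\ is_minimum f_oo m_oo,
           forall n, (0 < n)%N -> is_minimum (f_ w n) (m n) &
           m @ \oo --> m_oo]} /\
  {ae PP, forall w : Omega,
     forall mu : nat -> power_space Y k.+1,
       (forall n, (0 < n)%N -> minimizer (f_ w n) (mu n)) ->
       weakly_precompact mu /\
       forall nu, weak_limit_point mu nu -> minimizer f_oo nu}.
Proof.
move=> f_ f_oo; set Z := power_space Y k.+1.
have sepZ : separable Z by exact: power_space_separable.
have reflZ : reflexive_space Z by exact: power_space_reflexive.
have [e e_sep] := separating_functionals sepZ.
have [s s_dense] := dense_sequence sepZ.
have g_lsc : forall x (mu : Z) (xs : nat -> X) (mus : nat -> Z) a,
    xs @ \oo --> x -> weak_cvg mus mu -> a < min_dist d x mu ->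
    \forall n \near \oo, a < min_dist d (xs n) (mus n).
  by apply: min_dist_lsc => x y xs ys xsx ysy; have [] := d_lsc x y xs ys xsx ysy.
have := @ae_minima_convergence R X Z sepX sepZ reflZ r r_ge0
  (weakly_lsc_seq_wlsc r_lsc) r_coercive lambda lambda_gt0 (min_dist d)
  (fun x mu => min_dist_ge0 x mu d_ge0) g_lsc e e_sep s s_dense P
  (fun mu => measurable_min_dist mu d_meas)
  (fun mu => bounded_on_support_min_dist mu d_bounded)
  disp Omega PP xi xi_law xi_indep.
by move=> h; split; apply: filterS h => w [].
Qed.
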